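(* Fix $0<p<\tfrac12$, let $q=1-p$, $m_p=\lfloor 1/\log_2(1/q)\rfloor$, and let $\eta^*=\eta^*(p)$ be the unique solution $\eta\in(0,\tfrac12)$ of $h(\eta)=\log_2\frac{1}{1-p}$, where $h(\eta)=-\eta\log_2\eta-(1-\eta)\log_2(1-\eta)$. Then the random graph $Q_p=Q_p^d$ satisfies: (a) There exists $\delta=\delta(p)>0$ such that with very high probability every ball of radius $\delta d$ in $Q^d$ contains at most $m_p$ vertices of the fragment of $Q_p$. (b) For each $\varepsilon>0$ there is $\gamma=\gamma(\varepsilon,p)>0$ such that with very high probability, a proportion at most $e^{-\gamma d}$ of the vertices of $Q^d$ are within distance $(\eta^*-\varepsilon)d$ of the fragment, but all vertices of $Q^d$ are within distance $(\eta^*+\varepsilon)d$ of the fragment. (All distances are graph distances in $Q^d$.)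
   Context: $Q^d$ is the $d$-dimensional hypercube on $\{0,1\}^d$ (vertices adjacent iff they differ in exactly one coordinate). $Q_p=Q_p^d$ is the random spanning subgraph of $Q^d$ keeping each edge independently with probability $p$. The components of $Q_p$ are ordered by size (ties broken by a fixed canonical vertex ordering); the first (largest) is the giant, and the fragment is the union of all other components. For a vertex $u$ and $r>0$, the $r$-ball $B_r(u)$ is the set of vertices at $Q^d$-distance at most $r$ from $u$. ''With very high probability'' means with probability $1-e^{-\Omega(d)}$ as $d\to\infty$. *)

(* Defs.v *)
From HB Require Import structures.
From mathcomp Require Import all_boot all_order all_algebra.
Set Implicit Arguments.
Unset Strict Implicit.
Unset Printing Implicit Defensive.
Import Order.TTheory GRing.Theory Num.Theory.

Section Graph.
Variables (T : finType) (e : rel T).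

(* Length of a shortest walk. A pair joined by no walk gets the value #|T|,
   which exceeds every finite distance. *)
Definition gdist (u v : T) : nat :=
  find (fun n => [exists s : n.-tuple T, path e u s && (last u s == v)])
       (iota 0 #|T|).

Definition component (u : T) : {set T} := [set v | connect e u v].

Definition components : {set {set T}} := [set component u | u : T].

(* Larger sets come first; ties are broken by the earliest member in the
   enumeration of T. *)
Definition comp_order (A B : {set T}) : bool :=
  (#|B| < #|A|) ||
  (#|A| == #|B|) && (find (mem A) (enum T) <= find (mem B) (enum T)).

Definition giant : {set T} := head set0 (sort comp_order (enum components)).

Definition fragment : {set T} := \bigcup_(C in components :\ giant) C.

End Graph.

Section Hypercube.
Variable d : nat.

Definition cube : finType := {ffun 'I_d -> bool}.

Definition cube_adj : rel cube := fun u v => #|[set i | u i != v i]| == 1.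

Definition cube_edges : {set {set cube}} :=
  [set e : {set cube} | [exists u, exists v,
     cube_adj u v && (e == [set u; v])]].

Definition subgraph (w : {set {set cube}}) : rel cube :=
  fun u v => [set u; v] \in w.

End Hypercube.
Arguments cube_adj {d}.

From mathcomp Require Import classical_sets reals topology normedtype.
From mathcomp Require Import sequences exp.

Local Open Scope ring_scope.

Section Percolation.
Variable R : realType.

Definition ball_Q d (r : R) (u : cube d) : {set cube d} :=
  [set v | (gdist cube_adj u v)%:R <= r].

Definition within_Q d (r : R) (S : {set cube d}) (u : cube d) : bool :=
  [exists v in S, (gdist cube_adj u v)%:R <= r].

(* The law of Q_p^d, whose outcome is identified with its edge set. *)
Definition prob_Qp (p : R) d (A : pred {set {set cube d}}) : R :=
  \sum_(w in powerset (cube_edges d) | A w)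
    \prod_(e in cube_edges d) (if e \in w then p else 1 - p).

Definition wvhp (p : R) (A : forall d, pred {set {set cube d}}) : Prop :=
  exists2 c : R, 0 < c &
    (\forall d \near \oo%classic,
       1 - expR (- (c * d%:R)) <= prob_Qp p (A d)).

Definition log2 (x : R) : R := ln x / ln 2.

Definition entropy (x : R) : R := - x * log2 x - (1 - x) * log2 (1 - x).

Definition is_eta_star (p eta : R) : Prop :=
  0 < eta < 2^-1 /\ entropy eta = log2 (1 / (1 - p)).

Definition m_ (p : R) : int := Num.floor (1 / log2 (1 / (1 - p))).

End Percolation.

(* Main.v *)
(* Call a vertex low if fewer than d/N of its d edges are open, for a large
   constant N.

   Two vertices at distance at most 3 which are not low are joined by
   Omega(d^2) edge-disjoint detours of bounded length, so they are disconnected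
   with probability only exp(-Omega(d^2)); a union bound over all such pairs is
   affordable. Stars of distinct vertices are almost disjoint, so M given
   vertices are all low with probability about q^(Md), where q = 1 - p. Hence,
   as soon as 2 q^M < 1, no ball of radius d/N contains M low vertices. In
   particular each vertex has a neighbour which is not low, so all vertices
   which are not low lie in one component; as this component covers more than
   half of the cube it is the giant, and the fragment consists of low vertices.
   This is (a).

   For (b), the expected number of low vertices is about (2q)^d, and a ball of
   radius (eta - eps) d has exponentially fewer than 2^(h(eta) d) = q^(-d)
   vertices: Markov's inequality gives the first half. For the second half,
   isolated vertices belong to the fragment, and the vertices on a sphere have
   pairwise disjoint stars, so that they are isolated independently; a sphere of
   radius slightly above eta d has exponentially more than q^(-d) vertices and
   contains an isolated one except with doubly exponentially small
   probability. *)

Require Import Defs.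
From HB Require Import structures.
From mathcomp Require Import all_boot all_order all_algebra.
From mathcomp Require Import zify ring lra.
From mathcomp Require Import classical_sets reals topology normedtype.
From mathcomp Require Import sequences exp.
Set Implicit Arguments.
Unset Strict Implicit.
Unset Printing Implicit Defensive.
Import Order.TTheory GRing.Theory Num.Theory.
Local Open Scope ring_scope.

(** * Product Bernoulli measure on subsets of a finite set *)

Section Bernoulli.
Import mathcomp.boot.fintype mathcomp.boot.finset.
Variables (R : realFieldType) (p : R) (T : finType).
Implicit Types (E F w : {set T}) (f g : {set T} -> R).

Definition weight E w : R := \prod_(e in E) (if e \in w then p else 1 - p).

(** The edge set [E] is a parameter, so that the measure on [E] can be compared with its marginal on
    a subset of [E]. *)
Definition expect E f : R := \sum_(w in powerset E) weight E w * f w.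

Definition depends_on F f := forall w, f w = f (w :&: F).

Lemma sum_powerset_prod E (a b : T -> R) :
  \sum_(w in powerset E) \prod_(e in E) (if e \in w then a e else b e) =
  \prod_(e in E) (a e + b e).
Proof.
rewrite big_mkcond /= [RHS]big_mkcond /=.
(* An element outside [E] gets the factor 0 + 1; after distributing the product, every set not
   contained in [E] contributes 0. *)
rewrite [RHS](eq_bigr (fun e => (if e \in E then a e else 0) +
                           (if e \in E then b e else 1))); last first.
  by move=> e _; case: ifP => // _; rewrite add0r.
rewrite bigA_distr; apply: eq_bigr => w _.
rewrite powersetE; case: ifPn => [sw|]; last first.
  move=> /subsetPn[e ew eE]; rewrite (bigD1 e) //= ew (negPf eE) mul0r //.
rewrite [LHS]big_mkcond /=; apply: eq_bigr => e _.
case: (boolP (e \in E)) => // eE; case: ifPn => // ew.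
by rewrite (subsetP sw _ ew) in eE.
Qed.

Lemma expect_sum E (I : Type) (r : seq I) (P : pred I) (f : I -> {set T} -> R) :
  expect E (fun w => \sum_(i <- r | P i) f i w) =
  \sum_(i <- r | P i) expect E (f i).
Proof.
rewrite /expect exchange_big /=; apply: eq_bigr => w _.
by rewrite mulr_sumr.
Qed.

Lemma expectZ E c f : expect E (fun w => c * f w) = c * expect E f.
Proof. by rewrite /expect mulr_sumr; apply: eq_bigr => w _; rewrite mulrCA. Qed.

Lemma eq_expect E f g : {in powerset E, f =1 g} -> expect E f = expect E g.
Proof. by move=> fg; apply: eq_bigr => w wE; rewrite fg. Qed.

Lemma expect1 E : expect E (fun=> 1) = 1.
Proof.
rewrite /expect (eq_bigr (weight E)) => [|w _]; last by rewrite mulr1.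
by rewrite sum_powerset_prod big1 // => e _; rewrite subrKC.
Qed.

(** Fubini: [w] corresponds to the pair of its traces on [F] and [E :\: F], and the weight factors
    accordingly. *)
Lemma expect_split E F f : F \subset E ->
  expect E f = expect F (fun a => expect (E :\: F) (fun b => f (a :|: b))).
Proof.
move=> FE; rewrite /expect.
under [RHS]eq_bigr do rewrite mulr_sumr.
rewrite pair_big /=.
rewrite (reindex_onto (fun ab : {set T} * {set T} => ab.1 :|: ab.2)
   (fun w => (w :&: F, w :&: (E :\: F)))) /=; last first.
  move=> w; rewrite powersetE => wE.
  rewrite -setIUr; apply/setIidPl.
  by rewrite setDE setUIr setUCr setIT (setUidPr FE).
apply: eq_big => [[a b]|[a b]] /=.
  rewrite !powersetE xpair_eqE; apply/idP/idP.
    case/andP => abE /andP[/eqP <- /eqP <-].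
    by rewrite !subsetIr.
  case/andP=> aF bF; rewrite subUset (subset_trans aF FE).
  rewrite (subset_trans bF (subsetDl _ _)) /= !setIUl.
  rewrite (setIidPl aF) (setIidPl bF).
  have /eqP -> : b :&: F == set0.
    by rewrite setI_eq0; move: bF; rewrite subsetD => /andP[].
  have /eqP -> : a :&: (E :\: F) == set0.
    rewrite setI_eq0 disjoint_sym; apply: disjointWr aF _.
    by rewrite -setI_eq0 setIDAC setDIl setDv setI0.
  by rewrite setU0 set0U !eqxx.
case/andP=> _ /eqP[ea eb]; rewrite mulrA; congr (_ * _).
rewrite /weight (big_setID F) /= (setIidPr FE); congr (_ * _).
  apply: eq_bigr => e eF; congr (if _ then _ else _).
  by rewrite -[in RHS]ea [in RHS]inE eF andbT.
apply: eq_bigr => e eF; congr (if _ then _ else _).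
by rewrite -[in RHS]eb [in RHS]inE eF andbT.
Qed.

Lemma expect_depends E F f : F \subset E -> depends_on F f ->
  expect E f = expect F f.
Proof.
move=> FE fF; rewrite (expect_split _ FE); apply: eq_expect => a aF.
rewrite powersetE in aF.
rewrite (@eq_expect _ _ (fun=> f a * 1)); first by rewrite expectZ expect1 mulr1.
move=> b; rewrite powersetE => bE; rewrite mulr1 fF setIUl (setIidPl aF).
have /eqP -> : b :&: F == set0.
  by rewrite setI_eq0; move: bE; rewrite subsetD => /andP[].
by rewrite setU0.
Qed.

Lemma expect_indep E F f g : F \subset E -> depends_on F f ->
  depends_on (E :\: F) g ->
  expect E (fun w => f w * g w) = expect E f * expect E g.
Proof.
move=> FE fF gF; rewrite (expect_split _ FE) (expect_depends FE fF).
rewrite (expect_depends (subsetDl E F) gF) mulrC -expectZ.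
apply: eq_expect => a; rewrite powersetE => aF.
rewrite mulrC -expectZ; apply: eq_expect => b; rewrite powersetE => bF.
rewrite fF gF !setIUl (setIidPl aF) (setIidPl bF).
have /eqP -> : b :&: F == set0.
  by rewrite setI_eq0; move: bF; rewrite subsetD => /andP[].
have /eqP -> : a :&: (E :\: F) == set0.
  rewrite setI_eq0 disjoint_sym; apply: disjointWr aF _.
  by rewrite -setI_eq0 setIDAC setDIl setDv setI0.
by rewrite setU0 set0U.
Qed.

(** Peel off one index at a time: by disjointness the product of the remaining factors depends only
    on the complement of [F i]. *)
Lemma expect_prod E (I : eqType) (r : seq I) (F : I -> {set T})
    (f : I -> {set T} -> R) :
  uniq r -> {in r, forall i, F i \subset E} ->
  {in r &, forall i j, i != j -> [disjoint F i & F j]} ->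
  (forall i, depends_on (F i) (f i)) ->
  expect E (fun w => \prod_(i <- r) f i w) = \prod_(i <- r) expect E (f i).
Proof.
move=> + + + fF; elim: r => [|i r IHr] /=.
  by rewrite big_nil => _ _ _; rewrite -[RHS](expect1 E); apply: eq_expect => w;
     rewrite big_nil.
case/andP=> ir ur FE dF; rewrite big_cons -IHr //; first last.
- by move=> j k jr kr; apply: dF; rewrite inE ?jr ?kr orbT.
- by move=> j jr; apply: FE; rewrite inE jr orbT.
rewrite -(@expect_indep _ (F i)) //.
- by apply: eq_expect => w _; rewrite big_cons.
- by apply: FE; rewrite mem_head.
move=> w; rewrite !big_seq; apply: eq_bigr => j jr.
rewrite fF [in RHS]fF -setIA; congr (f j (w :&: _)).
apply/esym/setIidPr; rewrite subsetD FE ?inE ?jr ?orbT //=.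
apply: dF; rewrite ?inE ?eqxx ?jr ?orbT //.
by apply: contraNneq ir => <-.
Qed.

(** Generating function of the binomial number of open edges in [F]. The value x = 0 gives the
    probability that all are closed, and x = exp(-s) gives Chernoff bounds. *)
Lemma expect_expnI E F (x : R) : F \subset E ->
  expect E (fun w => x ^+ #|w :&: F|) = (1 - p + p * x) ^+ #|F|.
Proof.
move=> FE; rewrite (expect_depends FE); last by move=> w; rewrite -setIA setIid.
rewrite /expect -prodr_const.
rewrite [RHS](eq_bigr (fun e => p * x + (1 - p))) => [|e _]; last by rewrite addrC.
rewrite -sum_powerset_prod; apply: eq_bigr => w; rewrite powersetE => wF.
rewrite (setIidPl wF) /weight [RHS](big_setID w) [in LHS](big_setID w) /=.
rewrite (setIidPr wF) mulrAC -prodr_const -big_split /=; congr (_ * _).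
  by apply: eq_bigr => e ->.
by apply: eq_bigr => e; rewrite inE => /andP[/negPf ->].
Qed.

Lemma expect_closed E F : F \subset E ->
  expect E (fun w => (w :&: F == set0)%:R) = (1 - p) ^+ #|F|.
Proof.
move=> FE; have := expect_expnI 0 FE; rewrite mulr0 addr0 => <-.
by apply: eq_expect => w _; rewrite expr0n cards_eq0.
Qed.

Lemma expect_open E F : F \subset E ->
  expect E (fun w => (F \subset w)%:R) = p ^+ #|F|.
Proof.
move=> FE; rewrite (expect_depends FE) => [|w]; last by rewrite subsetI subxx andbT.
rewrite /expect (bigD1 F) ?powersetE //= subxx mulr1 big1 => [|w].
  rewrite addr0 /weight -prodr_const; apply: eq_bigr => e -> //.
rewrite powersetE => /andP[wF wNF]; rewrite [F \subset w](_ : _ = false) ?mulr0 //.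
by apply: contraNF wNF => Fw; rewrite eqEsubset wF.
Qed.

Hypothesis p01 : 0 <= p <= 1.

Lemma weight_ge0 E w : 0 <= weight E w.
Proof.
case/andP: p01 => p0 p1.
by apply: prodr_ge0 => e _; case: ifP => _; rewrite ?subr_ge0.
Qed.

Lemma expect_le E f g : {in powerset E, forall w, f w <= g w} ->
  expect E f <= expect E g.
Proof.
by move=> fg; apply: ler_sum => w wE; rewrite ler_wpM2l ?weight_ge0 ?fg.
Qed.

Definition Pr E (A : pred {set T}) : R := expect E (fun w => (A w)%:R).

Lemma Pr_le E (A B : pred {set T}) : {in powerset E, forall w, A w -> B w} ->
  Pr E A <= Pr E B.
Proof.
move=> AB; apply: expect_le => w wE; rewrite ler_nat.
by case: (A w) (AB w wE) => // ->.
Qed.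

Lemma Pr_ge0 E A : 0 <= Pr E A.
Proof.
by apply: sumr_ge0 => w _; rewrite mulr_ge0 ?weight_ge0.
Qed.

Lemma PrC E (A : pred {set T}) : Pr E A = 1 - Pr E (predC A).
Proof.
apply/eqP; rewrite eq_sym subr_eq -(expect1 E) /Pr /expect -big_split /=; apply/eqP.
by apply: eq_bigr => w _; rewrite -mulrDr /=; case: (A w); rewrite ?addr0 ?add0r.
Qed.

Lemma PrU E (A B : pred {set T}) : Pr E (predU A B) <= Pr E A + Pr E B.
Proof.
rewrite /Pr /expect -big_split /=; apply: ler_sum => w _.
rewrite -mulrDr ler_wpM2l ?weight_ge0 //.
by rewrite -natrD ler_nat; case: (A w); case: (B w).
Qed.

Lemma Pr_exists E (I : finType) (Q : pred I) (A : I -> pred {set T}) :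
  Pr E (fun w => [exists (i | Q i), A i w]) <= \sum_(i | Q i) Pr E (A i).
Proof.
rewrite -expect_sum; apply: expect_le => w _.
case: existsP => [[i /andP[Qi Ai]]|_]; last by rewrite sumr_ge0.
by rewrite (bigD1 i) //= Ai lerDl sumr_ge0.
Qed.

Lemma Pr_exists_le E (I : finType) (Q : pred I) (A : I -> pred {set T}) (b : R) :
  (forall i, Q i -> Pr E (A i) <= b) ->
  Pr E (fun w => [exists (i | Q i), A i w]) <= #|Q|%:R * b.
Proof.
move=> Ab; apply: le_trans (Pr_exists _ _ _) _.
rewrite mulr_natl -sumr_const; exact: ler_sum.
Qed.

Lemma markov E f (A : pred {set T}) (t : R) : 0 < t ->
  {in powerset E, forall w, 0 <= f w} ->
  {in powerset E, forall w, A w -> t <= f w} ->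
  Pr E A <= t^-1 * expect E f.
Proof.
move=> t0 f0 At; rewrite -expectZ; apply: expect_le => w wE.
case: (boolP (A w)) => [/(At _ wE)|_]; last by rewrite mulr_ge0 ?f0 // invr_ge0 ltW.
by move=> ?; rewrite mulrC ler_pdivlMr ?mul1r.
Qed.

Lemma Pr_none_closed E (I : finType) (S : {set I}) (F : I -> {set T}) n :
  {in S, forall i, F i \subset E} -> {in S, forall i, #|F i| = n} ->
  {in S &, forall i j, i != j -> [disjoint F i & F j]} ->
  Pr E (fun w => [forall i in S, w :&: F i != set0]) = (1 - (1 - p) ^+ n) ^+ #|S|.
Proof.
move=> FE Fn dF; rewrite -prodr_const -big_enum /=.
transitivity (\prod_(i <- enum S) expect E (fun w => (w :&: F i != set0)%:R)).
  rewrite -(expect_prod (F := F)).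
  - apply: eq_expect => w _; case: forall_inP => [wF|nF]; last first.
      have /existsP[i /andP[iS /negbNE wFi]] :
        [exists i in S, ~~ (w :&: F i != set0)].
        rewrite -negb_forall_in; apply/negP => /forall_inP; exact: nF.
      by rewrite big_enum (bigD1 i) //= wFi mul0r.
    by rewrite big_enum big1 // => i /wF ->.
  - exact: enum_uniq.
  - by move=> i; rewrite mem_enum; apply: FE.
  - by move=> i j; rewrite !mem_enum; apply: dF.
  - by move=> i w; rewrite -setIA setIid.
rewrite !big_enum; apply: eq_bigr => i iS.
rewrite -(Fn i iS) -(@expect_closed E) ?FE // -/(Pr E (fun w => w :&: F i != set0)) PrC.
by congr (1 - _); apply: eq_expect => w _ /=; rewrite negbK.
Qed.

(** The blocks are independent, and each is fully open with probability at least p^n because it has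
    at most [n] edges. *)
Lemma Pr_none_open E (I : finType) (S : {set I}) (F : I -> {set T}) n :
  {in S, forall i, F i \subset E} -> {in S, forall i, #|F i| <= n}%N ->
  {in S &, forall i j, i != j -> [disjoint F i & F j]} ->
  Pr E (fun w => [forall i in S, ~~ (F i \subset w)]) <= (1 - p ^+ n) ^+ #|S|.
Proof.
case/andP: p01 => p0 p1.
move=> FE Fn dF; rewrite -prodr_const -big_enum /=.
apply: le_trans (_ : \prod_(i <- enum S)
    expect E (fun w => (~~ (F i \subset w))%:R) <= _).
  rewrite -(expect_prod (F := F)).
  - apply: expect_le => w _; case: forall_inP => [wF|nF]; last first.
      by apply: prodr_ge0 => i _.
    by rewrite big_enum big1 // => i /wF ->.
  - exact: enum_uniq.
  - by move=> i; rewrite mem_enum; apply: FE.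
  - by move=> i j; rewrite !mem_enum; apply: dF.
  - by move=> i w; rewrite subsetI subxx andbT.
rewrite !big_enum; apply: ler_prod => i iS.
rewrite -/(Pr E (fun w => ~~ (F i \subset w))) Pr_ge0 /= PrC lerD2l lerN2.
rewrite [leRHS](_ : _ = p ^+ #|F i|).
  by rewrite ler_wiXn2l // Fn.
by rewrite -(@expect_open E) ?FE //; apply: eq_expect => w _ /=; rewrite negbK.
Qed.

End Bernoulli.

(** * Geometry of the cube *)

Section Cube.
Import mathcomp.boot.fintype mathcomp.boot.finset.
Variable d : nat.
Implicit Types (u v x y z : cube d) (i j k : 'I_d) (w : {set {set cube d}}).

Definition flip u i : cube d := [ffun k => u k (+) (k == i)].

Definition diff u v : {set 'I_d} := [set k | u k != v k].

Definition hamming u v := #|diff u v|.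

Definition edge u i : {set cube d} := [set u; flip u i].

Definition star u : {set {set cube d}} := [set edge u i | i : 'I_d].

Lemma flipK i : involutive (flip^~ i).
Proof. by move=> u; apply/ffunP => k; rewrite !ffunE addbK. Qed.

Lemma flipC u i j : flip (flip u i) j = flip (flip u j) i.
Proof. by apply/ffunP => k; rewrite !ffunE addbAC. Qed.

Lemma flip_inj u : injective (flip u).
Proof.
move=> i j /ffunP/(_ i); rewrite !ffunE eqxx => /addbI.
by case: eqP.
Qed.

Lemma flip_neq u i : flip u i != u.
Proof.
apply/eqP => /ffunP/(_ i); rewrite !ffunE eqxx addbT.
by case: (u i).
Qed.

Lemma diffC u v : diff u v = diff v u.
Proof. by apply/setP => k; rewrite !inE eq_sym. Qed.

Lemma hammingC u v : hamming u v = hamming v u.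
Proof. by rewrite /hamming diffC. Qed.

Lemma diff_flip u i : diff u (flip u i) = [set i].
Proof.
apply/setP => k; rewrite !inE !ffunE.
by case: (u k) (k == i) => [] [].
Qed.

Lemma mem_diff_flip u v i k :
  (k \in diff u (flip v i)) = (k \in diff u v) (+) (k == i).
Proof. by rewrite !inE ffunE; case: (u k) (v k) (k == i) => [] [] []. Qed.

Lemma hamming_flip_in u v i : i \in diff u v ->
  hamming u v = (hamming u (flip v i)).+1.
Proof.
move=> iD; rewrite /hamming (cardsD1 i) iD; congr (_.+1); apply: eq_card => k.
rewrite mem_diff_flip in_setD1.
by case: (eqVneq k i) => [->|_]; rewrite ?iD ?addbF.
Qed.

Lemma hamming_flip_notin u v i : i \notin diff u v ->
  hamming u (flip v i) = (hamming u v).+1.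
Proof.
move=> iD; have := @hamming_flip_in u (flip v i) i.
by rewrite mem_diff_flip eqxx (negPf iD) flipK => ->.
Qed.

Lemma hamming_triangle u v x : (hamming u v <= hamming u x + hamming x v)%N.
Proof.
apply: leq_trans (leq_card_setU _ _); apply: subset_leq_card.
apply/subsetP => k; rewrite !inE => uv; case: eqP => //= ux.
by rewrite -ux.
Qed.

Lemma hamming_le u v : (hamming u v <= d)%N.
Proof. by rewrite -[leqRHS]card_ord max_card. Qed.

Lemma hamming_eq0 u v : (hamming u v == 0)%N = (u == v).
Proof.
rewrite cards_eq0; apply/eqP/eqP => [D0|->]; last first.
  by apply/setP => k; rewrite !inE eqxx.
by apply/ffunP => k; move/setP/(_ k): D0; rewrite !inE => /negbFE/eqP.
Qed.

Lemma cube_adjP u v : reflect (exists i, v = flip u i) (cube_adj u v).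
Proof.
apply: (iffP idP) => [/cards1P[i /setP uv]|[i ->]]; last first.
  by rewrite /cube_adj -/(diff _ _) diff_flip cards1.
exists i; apply/ffunP => k; move: (uv k); rewrite !inE ffunE => <-.
by case: (u k) (v k) => [] [].
Qed.

Lemma card_cube : #|cube d| = (2 ^ d)%N.
Proof. by rewrite card_ffun card_bool card_ord. Qed.

Lemma walk_hamming (s : seq (cube d)) u :
  path cube_adj u s -> (hamming u (last u s) <= size s)%N.
Proof.
elim: s u => [|x s IHs] u /=; first by rewrite leqn0 hamming_eq0.
case/andP => /cube_adjP[i ->] /IHs {}IHs.
apply: leq_trans (hamming_triangle _ _ (flip u i)) _.
by rewrite {1}/hamming diff_flip cards1 add1n ltnS.
Qed.

Lemma hamming_walk u v : exists s : (hamming u v).-tuple (cube d),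
  path cube_adj u s && (last u s == v).
Proof.
have [n En] : {n | hamming u v = n} by exists (hamming u v).
rewrite En; elim: n u En => [|n IHn] u En.
  by exists [tuple]; rewrite /= -hamming_eq0 En.
have /set0Pn[i iD] : diff u v != set0 by rewrite -cards_eq0 -/(hamming u v) En.
have [|s sP] := IHn (flip u i).
  have := @hamming_flip_in v u i; rewrite diffC => /(_ iD).
  by rewrite hammingC En hammingC => -[].
by exists [tuple of flip u i :: s]; case/andP: sP => /= -> ->; rewrite !andbT; apply/cube_adjP; exists i.
Qed.

Lemma gdist_hamming u v : gdist cube_adj u v = hamming u v.
Proof.
rewrite /gdist; set a := (fun n : nat => _).
(* [gdist] searches lengths below 2^d only; the Hamming distance is at most d < 2^d, so it lies in
   the searched range. *)
have hN : (hamming u v < #|cube d|)%N.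
  by rewrite card_cube (leq_ltn_trans (hamming_le u v)) // ltn_expl.
have ah : a (hamming u v) by apply/existsP; exact: hamming_walk.
apply/eqP; rewrite eqn_leq; apply/andP; split; last first.
  case: (leqP #|cube d| (find a (iota 0 #|cube d|))) => [|fN].
    by apply: leq_trans; apply: ltnW.
  have hs : has a (iota 0 #|cube d|) by rewrite has_find size_iota.
  have := nth_find 0 hs; rewrite nth_iota ?add0n // => /existsP[s /andP[us /eqP vs]].
  by have := walk_hamming us; rewrite vs size_tuple.
rewrite leqNgt; apply/negP => /(before_find 0).
by rewrite nth_iota // add0n ah.
Qed.

Lemma edge_neq u v i j : edge u i = edge v j -> u != v -> u = flip v j.
Proof.
by move=> /setP/(_ u); rewrite !inE eqxx /= => /esym/orP[->|/eqP].
Qed.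

Lemma edge_inj u : injective (edge u).
Proof.
move=> i j /setP/(_ (flip u i)); rewrite !inE eqxx orbT (negPf (flip_neq _ _)) /=.
by move/esym/eqP/flip_inj.
Qed.

Lemma cube_edgesP (e : {set cube d}) :
  reflect (exists u i, e = edge u i) (e \in cube_edges d).
Proof.
rewrite inE; apply: (iffP existsP) => [[u /existsP[v /andP[/cube_adjP[i ->] /eqP ->]]]|].
  by exists u, i.
case=> u [i ->]; exists u; apply/existsP; exists (flip u i); rewrite eqxx andbT.
by apply/cube_adjP; exists i.
Qed.

Lemma edge_in u i : edge u i \in cube_edges d.
Proof. by apply/cube_edgesP; exists u, i. Qed.

Lemma star_sub u : star u \subset cube_edges d.
Proof. by apply/subsetP => e /imsetP[i _ ->]; apply: edge_in. Qed.

Lemma card_star u : #|star u| = d.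
Proof. by rewrite card_imset ?card_ord //; exact: edge_inj. Qed.

Lemma subgraphC w : symmetric (subgraph w).
Proof. by move=> u v; rewrite /subgraph setUC. Qed.

Lemma connect_subgraphC w : connect_sym (subgraph w).
Proof. exact/sym_connect_sym/subgraphC. Qed.

Lemma subgraph_flip w u v : w \subset cube_edges d -> subgraph w u v ->
  exists2 i, v = flip u i & edge u i \in w.
Proof.
move=> wE uvw; have /cube_edgesP[x [i uvx]] := subsetP wE _ uvw.
(* A loop would be a singleton, whereas edges of the cube have two vertices. *)
have uv : u != v.
  apply/eqP => uv; move/(congr1 (fun A : {set cube d} => #|A|)): uvx.
  by rewrite uv setUid cards1 cards2 eq_sym flip_neq.
have : flip u i = v.
  move/setP: uvx => uvx; have := uvx u; have := uvx v; rewrite !inE !eqxx ?orbT /=.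
  move=> /esym/orP[] /eqP ex /esym/orP[] /eqP ey; move: uv; rewrite ex ey ?eqxx //.
  by rewrite flipK.
by move=> uvi; exists i => //; rewrite /edge uvi.
Qed.

(** A common edge would make y and y' adjacent, but a single flip changes the distance to x by
    exactly one. Hence vertices on a sphere have independent stars. *)
Lemma starsD x y y' : hamming x y = hamming x y' -> y != y' ->
  [disjoint star y & star y'].
Proof.
move=> hy yy'; rewrite -setI_eq0; apply/eqP/setP => e; rewrite !inE.
apply/andP => -[/imsetP[i _ ->] /imsetP[j _ /edge_neq/(_ yy') ey]].
move: hy; rewrite ey; case: (boolP (j \in diff x y')) => jD.
  by rewrite (hamming_flip_in jD) => /eqP; rewrite -[X in X == _]addn0 -addn1 eqn_add2l.
by rewrite (hamming_flip_notin jD) => /eqP; rewrite -[X in _ == X]addn0 -addn1 eqn_add2l.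
Qed.

Lemma card_sphere x n : #|[set y | hamming x y == n]| = 'C(d, n).
Proof.
rewrite -[in RHS](card_ord d) -card_draws -(card_imset (f := diff x)) /=.
  apply: eq_card => A; rewrite [RHS]inE; apply/imsetP/idP => [[y + ->]|Ak].
    by rewrite inE.
  have DA : diff x [ffun i => x i (+) (i \in A)] = A.
    by apply/setP => i; rewrite !inE ffunE; case: (x i) (i \in A) => [] [].
  by exists [ffun i => x i (+) (i \in A)]; rewrite ?inE /hamming DA.
move=> y y' /setP Dy; apply/ffunP => i; move: (Dy i); rewrite !inE.
by case: (x i) (y i) (y' i) => [] [] [].
Qed.

(** * Low vertices and unions of stars *)

Definition degree w u := #|[set i | edge u i \in w]|.

Definition low N w : {set cube d} := [set u | (degree w u * N < d)%N].

Definition stars (U : {set cube d}) := \bigcup_(u in U) star u.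

Lemma stars_sub (U : {set cube d}) : stars U \subset cube_edges d.
Proof. by apply/bigcupsP => u _; apply: star_sub. Qed.

(** Count only the edges leaving [U]: each has exactly one endpoint in [U], and a vertex of [U] has
    at most |U| of its d neighbours inside [U]. *)
Lemma card_stars (U : {set cube d}) : (#|U| * (d - #|U|) <= #|stars U|)%N.
Proof.
pose A := [set ui : cube d * 'I_d | (ui.1 \in U) && (flip ui.1 ui.2 \notin U)].
have inj : {in A &, injective (fun ui : cube d * 'I_d => edge ui.1 ui.2)}.
  move=> [u i] [v j]; rewrite !inE /= => /andP[uU uiU] /andP[vU vjU] e.
  have [uv|uv] := eqVneq u v; first by move: e; rewrite uv => /edge_inj ->.
  by move: vjU; rewrite -(edge_neq e uv) uU.
apply: leq_trans (_ : #|[set edge ui.1 ui.2 | ui in A]| <= _)%N; last first.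
  apply/subset_leq_card/subsetP => e /imsetP[[u i]]; rewrite inE => /andP[/= uU _] ->.
  by apply/bigcupP; exists u => //; apply/imsetP; exists i.
rewrite card_in_imset // -[leqRHS]sum1_card.
rewrite (eq_bigl (fun ui : cube d * 'I_d => (ui.1 \in U) && (flip ui.1 ui.2 \notin U)));
  last by move=> ui; rewrite inE.
rewrite -(pair_big_dep (mem U) (fun u i => flip u i \notin U) (fun _ _ => 1%N)) /=.
rewrite -sum_nat_const; apply: leq_sum => u uU.
rewrite sum1dep_card leq_subLR -[leqLHS]card_ord -(cardsC [set i | flip u i \in U]).
apply: leq_add.
  rewrite -(card_imset _ (@flip_inj u)); apply/subset_leq_card/subsetP => v.
  by case/imsetP => i; rewrite inE => iU ->.
by apply/subset_leq_card/subsetP => i; rewrite !inE.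
Qed.

Lemma card_stars_open w (U : {set cube d}) : (#|w :&: stars U| <= \sum_(u in U) degree w u)%N.
Proof.
rewrite /stars big_distrr /=.
elim/big_rec2: _ => [|u m B _ IH]; first by rewrite cards0.
apply: leq_trans (leq_card_setU _ _) _; apply: leq_add => //.
rewrite /degree -(card_imset _ (@edge_inj u)).
apply/subset_leq_card/subsetP => e; rewrite inE => /andP[ew /imsetP[i _ ei]].
by rewrite ei; apply: imset_f; rewrite inE -ei.
Qed.

(** * Detours between nearby vertices *)

Fixpoint edge_path x (ks : seq 'I_d) : seq {set cube d} :=
  if ks is k :: ks' then edge x k :: edge_path (flip x k) ks' else [::].

Lemma size_edge_path x ks : size (edge_path x ks) = size ks.
Proof. by elim: ks x => //= k ks IH x; rewrite IH. Qed.

Lemma edge_path_sub x ks : {subset edge_path x ks <= cube_edges d}.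
Proof.
elim: ks x => //= k ks IH x e; rewrite inE => /orP[/eqP ->|]; first exact: edge_in.
exact: IH.
Qed.

Lemma edge_path_rcons x ks k :
  edge_path x (rcons ks k) = rcons (edge_path x ks) (edge (foldl flip x ks) k).
Proof. by elim: ks x => //= l ks IH x; rewrite IH. Qed.

Lemma edge_path_connect w x ks : {subset edge_path x ks <= w} ->
  connect (subgraph w) x (foldl flip x ks).
Proof.
elim: ks x => [|k ks IH] x /= sub; first exact: connect0.
apply: connect_trans (connect1 _) (IH _ _).
  by apply: sub; rewrite mem_head.
by move=> e es; apply: sub; rewrite inE es orbT.
Qed.

Lemma foldl_flip x ks i : foldl flip (flip x i) ks = flip (foldl flip x ks) i.
Proof. by elim: ks x => //= k ks IH x; rewrite flipC IH. Qed.

Lemma foldl_flip_diff u v : foldl flip u (enum (diff u v)) = v.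
Proof.
(* Only the parity of the number of flips of a coordinate matters. *)
have E ks x k : (foldl flip x ks) k = x k (+) odd (count_mem k ks).
  elim: ks x => [|l ks IH] x /=; first by rewrite addbF.
  by rewrite IH ffunE oddD -addbA; congr (_ (+) _); rewrite eq_sym; case: eqP.
apply/ffunP => k; rewrite E count_uniq_mem ?enum_uniq // mem_enum inE.
by case: (u k) (v k) => [] [].
Qed.

(** Flips inside [D] leave the trace of [diff u] outside [D] unchanged, so both endpoints of every
    edge keep the trace [S]. *)
Lemma edge_path_diff u (D S : {set 'I_d}) x ks e : diff u x :\: D = S ->
  {subset ks <= D} -> e \in edge_path x ks ->
  \bigcup_(z in e) (diff u z :\: D) = S.
Proof.
have flipD y k : k \in D -> diff u (flip y k) :\: D = diff u y :\: D.
  move=> kD; apply/setP => l; rewrite !(in_setD, mem_diff_flip).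
  by case: eqVneq => [->|_]; rewrite ?kD // addbF.
elim: ks x => //= k ks IH x xS ksD; have kD : k \in D by rewrite ksD ?mem_head.
rewrite inE => /orP[/eqP ->|].
  by rewrite bigcup_setU !big_set1 flipD // xS setUid.
apply: IH; first by rewrite flipD.
by move=> l lks; apply: ksD; rewrite inE lks orbT.
Qed.

(** The middle part of a walk from u to v: from u flipped at i, flip j, then all of [diff u v], then
    i, arriving at v flipped at j. The two end edges [edge u i] and [edge v j] are left out, since
    they are chosen open. *)
Definition detour u v i j : {set {set cube d}} :=
  [set e in edge_path (flip u i) (j :: rcons (enum (diff u v)) i)].

Lemma detour_sub u v i j : detour u v i j \subset cube_edges d.
Proof. by apply/subsetP => e; rewrite inE; apply: edge_path_sub. Qed.

Lemma card_detour u v i j : (#|detour u v i j| <= hamming u v + 2)%N.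
Proof.
rewrite cardsE; apply: leq_trans (card_size _) _.
by rewrite size_edge_path /= size_rcons -cardE addn2.
Qed.

Lemma detour_connect w u v i j : edge u i \in w -> edge v j \in w ->
  detour u v i j \subset w -> connect (subgraph w) u v.
Proof.
move=> ui vj sub; apply: connect_trans (connect1 ui) _.
rewrite connect_subgraphC; apply: connect_trans (connect1 vj) _.
rewrite connect_subgraphC.
have := @edge_path_connect w (flip u i) (j :: rcons (enum (diff u v)) i).
rewrite /= foldl_rcons !foldl_flip foldl_flip_diff (flipC (flip v i)) flipK.
by apply => e es; apply: (subsetP sub); rewrite inE.
Qed.

(* The coordinates outside [diff u v] in which some endpoint of an edge of the
   detour differs from [u] are exactly [i] and [j]. *)
Lemma detour_coord u v i j e : i \notin diff u v -> j \notin diff u v -> i != j ->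
  e \in detour u v i j ->
  \bigcup_(z in e) (diff u z :\: diff u v) = [set i; j].
Proof.
set D := diff u v => iD jD ij.
have Di : diff u (flip u i) :\: D = [set i].
  by rewrite diff_flip; apply/setDidPl; rewrite disjoints1.
have Dij : diff u (flip (flip u i) j) :\: D = [set i; j].
  apply/setP => k; rewrite in_setD mem_diff_flip diff_flip in_setU !in_set1.
  case: (eqVneq k i) => [->|_]; first by rewrite (negPf ij) iD.
  by case: (eqVneq k j) => [->|_]; rewrite ?andbF // jD.
have stepE x k : (k \in diff u x :\: D) || (k \notin D) ->
  \bigcup_(z in edge x k) (diff u z :\: D) = k |: (diff u x :\: D).
  move=> kD; rewrite bigcup_setU !big_set1; apply/setP => l.
  rewrite !in_setU in_set1 !in_setD mem_diff_flip.
  move: kD; rewrite in_setD; case: (eqVneq l k) => [->|_]; rewrite ?addbF ?orbb //.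
  by case: (k \in D) (k \in diff u x) => [] [].
rewrite inE /= inE => /orP[/eqP ->|].
  by rewrite stepE ?jD ?orbT // Di setUC.
rewrite edge_path_rcons mem_rcons inE => /orP[/eqP ->|].
  have -> : \bigcup_(z in edge (foldl flip (flip (flip u i) j) (enum D)) i)
              (diff u z :\: D) = i |: (diff u (flip (flip v i) j) :\: D).
    by rewrite !foldl_flip foldl_flip_diff stepE // iD orbT.
  apply/setP => k; rewrite !in_setU in_setD !in_set1 !mem_diff_flip -/D.
  case: (eqVneq k i) => [->|_] //=; rewrite addbF.
  by case: (eqVneq k j) => [->|_]; rewrite ?jD ?(negPf jD) // addbF andNb.
apply: (edge_path_diff Dij) => k; by rewrite mem_enum.
Qed.

End Cube.

(** * The giant and the fragment *)

Section Giant.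
Import mathcomp.boot.fintype mathcomp.boot.finset.
Variables (T : finType) (e : rel T).
Implicit Types (A B C : {set T}) (u v : T).

Lemma comp_order_total : total (@comp_order T).
Proof.
move=> A B; rewrite /comp_order; case: (ltngtP #|A| #|B|) => //= _.
exact: leq_total.
Qed.

Lemma comp_order_trans : transitive (@comp_order T).
Proof.
move=> B A C /orP[AB|/andP[/eqP AB fAB]] /orP[BC|/andP[/eqP BC fBC]]; apply/orP.
- by left; apply: ltn_trans AB.
- by left; rewrite -BC.
- by left; rewrite AB.
- by right; rewrite AB BC eqxx (leq_trans fAB).
Qed.

Lemma mem_component u : u \in component e u.
Proof. by rewrite inE connect0. Qed.

Lemma component_in u : component e u \in components e.
Proof. exact: imset_f. Qed.

Lemma component_eq u v : connect_sym e -> connect e u v ->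
  component e u = component e v.
Proof. by move=> eC uv; apply/setP => z; rewrite !inE (same_connect eC uv). Qed.

Lemma giant_max C : C \in components e ->
  (giant e \in components e) /\ (#|C| <= #|giant e|)%N.
Proof.
rewrite -mem_enum /giant => CC.
have := sort_sorted comp_order_total (enum (components e)).
have := mem_sort (@comp_order T) (enum (components e)).
(* The component [C] rules out an empty list, for which [head] would return its default [set0]. *)
case: (sort _ _) => [/(_ C)|A s memE]; first by rewrite CC.
move=> /(order_path_min comp_order_trans)/allP /= As; split.
  by rewrite -mem_enum -memE mem_head.
have : C \in A :: s by rewrite memE.
rewrite inE => /orP[/eqP -> //|/As /orP[/ltnW //|/andP[/eqP -> //]]].
Qed.

Lemma fragmentP u : connect_sym e -> (u \in fragment e) = (component e u != giant e).
Proof.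
move=> eC; apply/bigcupP/idP => [[C]|uG]; last first.
  by exists (component e u); rewrite ?mem_component // in_setD1 uG component_in.
rewrite in_setD1 => /andP[CG /imsetP[v _ Cv]] uC.
by move: uC CG; rewrite Cv inE => /(component_eq eC) ->.
Qed.

(** If the giant meets the complement of [L], connectivity identifies it with the component of u.
    Otherwise it has at most |L| vertices, fewer than that component, which contains the complement
    of [L]; this contradicts maximality. *)
Lemma giant_component (L : {set T}) u : connect_sym e ->
  (forall v1 v2, v1 \notin L -> v2 \notin L -> connect e v1 v2) ->
  (2 * #|L| < #|T|)%N -> u \notin L -> giant e = component e u.
Proof.
move=> eC conn Lhalf uL; have [/imsetP[v _ Gv] leG] := giant_max (component_in u).
case: (boolP [exists x in giant e, x \notin L]) => [/exists_inP[x]|].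
  rewrite Gv inE => vx xL.
  by rewrite (component_eq eC vx); apply: component_eq => //; apply: conn.
rewrite negb_exists_in => /forall_inP GL.
have : (#|giant e| <= #|L|)%N.
  by apply/subset_leq_card/subsetP => x /GL; rewrite negbK.
move/(leq_trans leG); have : (#|~: L| <= #|component e u|)%N.
  by apply/subset_leq_card/subsetP => x; rewrite !inE => /(conn _ _ uL).
by have := cardsC L; lia.
Qed.

End Giant.

(** * Deterministic conditions that place the fragment among the low vertices *)

Section FragmentLow.
Import mathcomp.boot.fintype mathcomp.boot.finset.
Variables (d N : nat) (w : {set {set cube d}}).
Hypotheses (d_gt0 : (0 < d)%N) (wE : w \subset cube_edges d).
Hypothesis conn : forall u v : cube d, u \notin low N w -> v \notin low N w ->
  (hamming u v <= 3)%N -> connect (subgraph w) u v.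
Hypothesis dense : forall u : cube d,
  exists2 v, v \notin low N w & (hamming u v <= 1)%N.
Hypothesis few : (2 * #|low N w| < #|cube d|)%N.

Let connC := @connect_subgraphC d w.

(** Induction on the distance. Flip two coordinates of u towards v, then move by at most one step to
    a vertex x that is not low. So x is within 3 of u, and strictly closer to v than u is. *)
Lemma connect_not_low (u v : cube d) : u \notin low N w -> v \notin low N w ->
  connect (subgraph w) u v.
Proof.
have [n] := ubnP (hamming u v); elim: n u => // n IHn u; rewrite ltnS => uvn uL vL.
have [uv|uv] := leqP (hamming u v) 3; first exact: conn.
have /set0Pn[i iD] : diff v u != set0.
  by rewrite -cards_eq0 -/(hamming v u) hammingC; case: hamming uv.
have /set0Pn[j jD] : diff v (flip u i) != set0.
  rewrite -cards_eq0 -/(hamming v (flip u i)); have := hamming_flip_in iD.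
  by rewrite hammingC => huv; move: uv; rewrite huv; case: hamming.
have [x xL xu] := dense (flip (flip u i) j).
have hux : (hamming u x <= 3)%N.
  apply: leq_trans (hamming_triangle _ _ (flip (flip u i) j)) _.
  suff : (hamming u (flip (flip u i) j) <= 2)%N by lia.
  apply: leq_trans (hamming_triangle _ _ (flip u i)) _.
  by rewrite /hamming !diff_flip !cards1.
apply: connect_trans (conn uL xL hux) _; apply: IHn => //.
have := hamming_triangle x v (flip (flip u i) j); rewrite [hamming x (flip _ _)]hammingC.
have := hamming_flip_in iD; have := hamming_flip_in jD.
by rewrite !(hammingC v) => e1 e2; move: uvn; rewrite e2 e1; lia.
Qed.

Lemma fragment_low : fragment (subgraph w) \subset low N w.
Proof.
apply/subsetP => u; rewrite fragmentP //; apply: contraNT => uL.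
by rewrite (giant_component connC connect_not_low few uL).
Qed.

(** An isolated vertex has degree 0 and so is low. The giant is the component of a vertex that is
    not low, and a walk from u to it would have to start with an open edge at u. *)
Lemma isolated_fragment u : w :&: star u == set0 -> u \in fragment (subgraph w).
Proof.
move=> /eqP/setP uw; rewrite fragmentP //.
have isol i : edge u i \notin w.
  by move: (uw (edge u i)); rewrite !inE imset_f // andbT => ->.
have uL : u \in low N w.
  rewrite inE /degree (_ : [set _ | _] = set0) ?cards0 //.
  by apply/setP => i; rewrite !inE (negPf (isol i)).
have [v vL _] := dense u.
rewrite (giant_component connC connect_not_low few vL).
apply/eqP => uv; have := mem_component (subgraph w) v; rewrite -uv inE.
case/connectP => [[|x s]] /=; first by move=> _ vu; rewrite vu uL in vL.
by case/andP => /(subgraph_flip wE)[i _ ui]; move: (isol i); rewrite ui.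
Qed.

End FragmentLow.

(** * Probability estimates *)

Section FiniteSets.
Import mathcomp.boot.fintype mathcomp.boot.finset.

Lemma subset_of_card (T : finType) (A : {set T}) M : (M <= #|A|)%N ->
  exists2 U : {set T}, U \subset A & #|U| = M.
Proof.
move=> MA; exists [set x in take M (enum A)].
  by apply/subsetP => x; rewrite inE => /mem_take; rewrite mem_enum.
rewrite cardsE (card_uniqP _) ?take_uniq ?enum_uniq // size_take -cardE.
by case: ltngtP MA.
Qed.

Lemma leq_card_setD (T : finType) (A B : {set T}) m :
  (m + #|B| <= #|A|)%N -> (m <= #|A :\: B|)%N.
Proof.
move=> mA; rewrite cardsD.
apply: leq_trans (leq_sub2l _ (subset_leq_card (subsetIr A B))).
by rewrite -(addnK #|B| m) leq_sub2r.
Qed.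

Lemma bin_leq_expn n m : ('C(n, m) <= n ^ m)%N.
Proof.
elim: n m => [|n IHn] [|m] //; rewrite binS.
apply: leq_trans (leq_add (IHn m.+1) (IHn m)) _.
rewrite expnS -mulSnr [leqRHS]expnS; apply: leq_mul => //.
by case: m => // m; rewrite leq_exp2r.
Qed.

End FiniteSets.

Lemma prob_QpE (R : realType) (p : R) d (A : pred {set {set cube d}}) :
  prob_Qp p A = Pr p (cube_edges d) A.
Proof.
rewrite /prob_Qp big_mkcondr; apply: eq_bigr => w _.
by case: (A w); rewrite ?mulr1 ?mulr0.
Qed.

Section Estimates.
Import mathcomp.boot.fintype mathcomp.boot.finset.
Variables (R : realType) (p : R).
Hypothesis hp : 0 < p < 2^-1.

Let q : R := 1 - p.
Let p_gt0 : 0 < p. Proof. by case/andP: hp. Qed.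
Let p_lt_q : p < q. Proof. by case/andP: hp => _ ?; rewrite /q; lra. Qed.
Let q_gt0 : 0 < q. Proof. exact: lt_trans p_lt_q. Qed.
Let q_lt1 : q < 1. Proof. by rewrite /q ltrBlDr ltrDl. Qed.
Let p01 : 0 <= p <= 1. Proof. by rewrite !ltW ?(lt_trans p_lt_q). Qed.

Lemma sum_hamming d (x : cube d) (z : R) :
  \sum_(y : cube d) z ^+ hamming x y = (1 + z) ^+ d.
Proof.
transitivity (\prod_(i < d) \sum_(b : bool) (if x i != b then z else 1)).
  rewrite bigA_distr_bigA; apply: eq_bigr => y _.
  by rewrite /hamming -prodr_const big_mkcond; apply: eq_bigr => i _; rewrite inE.
rewrite (eq_bigr (fun=> 1 + z)) ?prodr_const ?card_ord // => i _.
rewrite big_bool; case: (x i) => //=; exact: addrC.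
Qed.

(** Chernoff bound: the indicator of distance at most r is at most exp(t (r - distance)), and the
    sum over the cube factors over coordinates. *)
Lemma card_ball d (x : cube d) (r t : R) : 0 <= t ->
  #|ball_Q r x|%:R <= expR (t * r) * (1 + expR (- t)) ^+ d.
Proof.
move=> t0; rewrite -(sum_hamming x) mulr_sumr.
rewrite -sum1_card natr_sum big_mkcond /=; apply: ler_sum => y _.
rewrite inE gdist_hamming -expRM_natr -expRD; case: ifP => [hr|_]; last exact: expR_ge0.
by rewrite -[leLHS]expR0 ler_expR mulNr -mulrBr mulr_ge0 // subr_ge0.
Qed.

(** Chernoff bound: if all of [U] is low, at most |U| d / N edges of [stars U] are open. The base q
    + p exp(-s) is at most 1, so the lower bound of [card_stars] may replace the exponent. *)
Lemma Pr_low d N (U : {set cube d}) (s : R) : 0 <= s -> (0 < N)%N ->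
  Pr p (cube_edges d) (fun w => U \subset low N w) <=
  expR (s * (#|U|%:R * d%:R / N%:R)) *
  (q + p * expR (- s)) ^+ (#|U| * (d - #|U|)).
Proof.
move=> s0 N0; have es1 : expR (- s) <= 1 by rewrite expR_le1 oppr_le0.
apply: le_trans (_ : expR (s * (#|U|%:R * d%:R / N%:R)) *
   (q + p * expR (- s)) ^+ #|stars U| <= _); last first.
  apply: ler_wpM2l; first exact: expR_ge0.
  apply: ler_wiXn2l; last exact: card_stars.
    by rewrite addr_ge0 ?mulr_ge0 ?expR_ge0 ?ltW.
  by rewrite -[leRHS](subrK p) lerD2l ler_piMr // ltW.
rewrite -(expect_expnI _ _ (stars_sub U)) -expectZ; apply: expect_le => // w _.
case: (boolP (_ \subset _)) => [UL|_]; last by rewrite mulr_ge0 ?exprn_ge0 ?expR_ge0.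
rewrite -expRM_natr -expRD -[leLHS]expR0 ler_expR mulNr -mulrBr mulr_ge0 // subr_ge0.
rewrite ler_pdivlMr ?ltr0n // -!natrM ler_nat.
apply: leq_trans (leq_mul (card_stars_open w U) (leqnn N)) _.
rewrite -sum_nat_const big_distrl; apply: leq_sum => u uU.
by have := subsetP UL u uU; rewrite inE => /ltnW.
Qed.

(** A single [N] makes balls of radius d/N cost at most exp(k d) and brings the rate of lowness
    within k of ln q, for every [M]. First s is chosen with exp(-s) at most k/2, then N with s/N at
    most k/2. *)
Lemma low_rate (k : R) : 0 < k -> exists2 N, (0 < N)%N &
  (forall d (x : cube d), #|ball_Q (N%:R^-1 * d%:R : R) x|%:R <= expR (k * d%:R)) /\
  (forall M, exists2 C : R, 0 < C & forall d (U : {set cube d}), (M <= d)%N ->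
    #|U| = M -> Pr p (cube_edges d) (fun w => U \subset low N w) <=
                C * expR (M%:R * (ln q + k) * d%:R)).
Proof.
move=> k0; pose s := Num.max 0 (- ln (k / 2)).
have s0 : 0 <= s by rewrite le_max lexx.
have k20 : 0 < k / 2 by lra.
have es : expR (- s) <= k / 2.
  by rewrite -[leRHS](@lnK R) ?posrE // ler_expR lerNl le_max lexx orbT.
have [N N0 sN] : exists2 N, (0 < N)%N & s / N%:R <= k / 2.
  exists (Num.bound (s / (k / 2))).+1 => //; rewrite ler_pdivrMr ?ltr0n //.
  rewrite mulrC -ler_pdivrMr //; apply: ltW; apply: lt_le_trans (archi_boundP _) _.
    by rewrite divr_ge0 // ltW.
  by rewrite ler_nat.
exists N => //; split=> [d x|M].
  apply: le_trans (card_ball x _ s0) _.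
  rewrite [k](splitr k) mulrDl expRD; apply: ler_pM; rewrite ?expR_ge0 ?exprn_ge0 //.
  - by rewrite addr_ge0 ?expR_ge0.
  - by rewrite ler_expR mulrA ler_wpM2r.
  rewrite expRM_natr; apply: lerXn2r; rewrite ?nnegrE ?expR_ge0 ?addr_ge0 ?expR_ge0 //.
  by apply: le_trans (expR_ge1Dx _); rewrite lerD2l.
pose a := ln q + k / 2.
(* As p < q, the left side is at most q (1 + k/2). *)
have base : q + p * expR (- s) <= expR a.
  rewrite /a expRD lnK ?posrE //; apply: le_trans (_ : q * (1 + k / 2) <= _).
    by rewrite mulrDr mulr1 lerD2l; apply: ler_pM; rewrite ?expR_ge0 // ltW.
  by rewrite ler_wpM2l ?expR_ge1Dx // ltW.
(* This constant absorbs the difference between M (d - M) and M d in the exponent. *)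
exists (expR (- a * (M%:R * M%:R))); first exact: expR_gt0.
move=> d U Md UM; apply: le_trans (Pr_low U s0 N0) _; rewrite UM.
apply: le_trans (_ : expR (M%:R * (k / 2) * d%:R) * expR (a * (M * (d - M))%:R) <= _).
  apply: ler_pM; first exact: expR_ge0.
  - by rewrite exprn_ge0 // addr_ge0 ?mulr_ge0 ?expR_ge0 // ltW.
  - rewrite ler_expR [leLHS](_ : _ = M%:R * (s / N%:R) * d%:R); last by ring.
    by apply: ler_wpM2r => //; apply: ler_wpM2l.
  rewrite expRM_natr; apply: lerXn2r => //; rewrite ?nnegrE ?expR_ge0 //.
  by rewrite addr_ge0 ?mulr_ge0 ?expR_ge0 // ltW.
rewrite -!expRD ler_expR natrM natrB // /a le_eqVlt; apply/orP; left; apply/eqP.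
by field.
Qed.

(** Union bound over the centre, at most 2^d choices, and over the [M]-subsets of its ball, at most
    b^M choices. *)
Lemma Pr_ball_low d N M (r b c : R) : 0 <= b -> 0 <= c ->
  (forall x : cube d, #|ball_Q r x|%:R <= b) ->
  (forall U : {set cube d}, #|U| = M ->
     Pr p (cube_edges d) (fun w => U \subset low N w) <= c) ->
  Pr p (cube_edges d)
    (fun w => [exists x : cube d, M <= #|ball_Q r x :&: low N w|]%N) <=
  2 ^+ d * (b ^+ M * c).
Proof.
move=> b0 c0 ballb Uc.
apply: le_trans (_ : Pr p (cube_edges d) (fun w => [exists (x : cube d | true),
   [exists (U : {set cube d} | (U \subset ball_Q r x) && (#|U| == M)),
   U \subset low N w]]) <= _).
  apply: Pr_le => // w _ /existsP[x /subset_of_card[U]].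
  rewrite subsetI => /andP[Ub Ul] UM; apply/existsP; exists x.
  by apply/existsP; exists U; rewrite Ub UM eqxx.
apply: le_trans (Pr_exists_le p01 (b := b ^+ M * c) _) _ => [x _|]; last first.
  rewrite -natrX -card_cube; apply: ler_wpM2r; first by rewrite mulr_ge0 ?exprn_ge0.
  by rewrite ler_nat max_card.
apply: le_trans (Pr_exists_le p01 (b := c) _) _ => [U /andP[_ /eqP]|]; first exact: Uc.
apply: ler_wpM2r => //; apply: le_trans (_ : (#|ball_Q r x| ^ M)%:R <= _); last first.
  by rewrite natrX; apply: lerXn2r => //; rewrite nnegrE.
by rewrite ler_nat; apply: leq_trans (bin_leq_expn _ _); rewrite -cards_draws cardsE.
Qed.

(** Markov's inequality: the expected proportion of low vertices is the average of the probabilities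
    of being low. *)
Lemma Pr_card_low d N (c t : R) : 0 < t -> 
  (forall u : cube d, Pr p (cube_edges d) (fun w => [set u] \subset low N w) <= c) ->
  Pr p (cube_edges d) (fun w => t <= #|low N w|%:R / #|cube d|%:R) <= t^-1 * c.
Proof.
move=> t0 uc; pose f (w : {set {set cube d}}) : R := #|low N w|%:R / #|cube d|%:R.
have cube0 : (0 < #|cube d|%:R :> R) by rewrite card_cube ltr0n expn_gt0.
apply: le_trans (markov p01 (f := f) t0 _ _) _ => [w _|//|]; first exact: divr_ge0.
apply: ler_wpM2l; first by rewrite invr_ge0 ltW.
rewrite (@eq_expect _ _ _ _ _ (fun w => \sum_(u : cube d)
    #|cube d|%:R^-1 * ([set u] \subset low N w)%:R)); last first.
  move=> w _; rewrite -mulr_sumr mulrC; congr (_ * _).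
  rewrite -sum1_card natr_sum big_mkcond; apply: eq_bigr => u _.
  by rewrite sub1set; case: (_ \in _).
rewrite expect_sum.
apply: le_trans (_ : \sum_(u : cube d) #|cube d|%:R^-1 * c <= _).
  by apply: ler_sum => u _; rewrite expectZ ler_wpM2l ?invr_ge0 ?uc.
by rewrite sumr_const -[_ *+ _]mulr_natl mulVKf // gt_eqF.
Qed.

(** Choose [n] open directions [A] at u and [B] at v, disjoint from each other and from [diff u v];
    degree 2n + 3 leaves room for this. If u and v are disconnected, all n^2 detours fail. As [A]
    and [B] depend on [w], the union bound runs over all quadruples (u, v, A, B). *)
Lemma Pr_disconnected d N n : (0 < N)%N -> ((2 * n + 3) * N <= d)%N ->
  Pr p (cube_edges d) (fun w => [exists u, exists v : cube d,
    [&& u \notin low N w, v \notin low N w, (hamming u v <= 3)%N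
      & ~~ connect (subgraph w) u v]]) <= 16 ^+ d * (1 - p ^+ 5) ^+ (n * n).
Proof.
move=> N0 nd.
pose Q (t : cube d * cube d * {set 'I_d} * {set 'I_d}) :=
  let: (u, v, A, B) := t in [&& (hamming u v <= 3)%N, #|A| == n, #|B| == n,
    [disjoint A & B], [disjoint A & diff u v] & [disjoint B & diff u v]].
apply: le_trans (_ : Pr p (cube_edges d) (fun w => [exists (t | Q t),
  [forall ij in setX t.1.2 t.2, ~~ (detour t.1.1.1 t.1.1.2 ij.1 ij.2 \subset w)]]) <= _).
  apply: Pr_le => // w _ /existsP[u /existsP[v /and4P[uL vL uv uvw]]].
  pose open x := [set i | edge x i \in w].
  have deg x : x \notin low N w -> (2 * n + 3 <= #|open x|)%N.
    rewrite inE -leqNgt => dx.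
    by rewrite -(leq_pmul2r N0); apply: leq_trans nd dx.
  have [A AsubD An] : exists2 A : {set 'I_d}, A \subset open u :\: diff u v & #|A| = n.
    apply: subset_of_card.
    apply: leq_card_setD; apply: leq_trans (deg _ uL).
    by rewrite -/(hamming u v) (leq_trans (leq_add (leqnn n) uv)) // leq_add2r leq_pmull.
  have [B BsubD Bn] : exists2 B : {set 'I_d},
      B \subset (open v :\: diff u v) :\: A & #|B| = n.
    apply: subset_of_card.
    apply: leq_card_setD; rewrite An; apply: leq_card_setD.
    apply: leq_trans (deg _ vL).
    by rewrite -/(hamming u v) addnn -mul2n leq_add2l.
  move: AsubD BsubD; rewrite !subsetD => /andP[Au AD] /andP[/andP[Bv BD] BA].
  apply/existsP; exists (u, v, A, B); rewrite /Q uv An Bn !eqxx AD BD disjoint_sym BA /=.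
  apply/forall_inP => -[i j]; rewrite inE /= => /andP[iA jB].
  apply: contraNN uvw; apply: detour_connect.
    by have := subsetP Au _ iA; rewrite inE.
  by have := subsetP Bv _ jB; rewrite inE.
apply: le_trans (Pr_exists_le p01 (b := (1 - p ^+ 5) ^+ (n * n)) _) _ => [|]; last first.
  (* Each of u, v, A, B has 2^d possible values, whence the factor 16^d. *)
  apply: ler_wpM2r; first by rewrite exprn_ge0 // subr_ge0 exprn_ile1 // ltW // (lt_trans p_lt_q).
  rewrite -natrX ler_nat; apply: leq_trans (max_card _) _.
  by rewrite !card_prod !card_cube -!cardsT -powersetT card_powerset cardsT card_ord -!expnMn.
move=> [[[u v] A] B] /= /and5P[uv /eqP An /eqP Bn AB /andP[AD BD]].
rewrite -{1}An -Bn -cardsX.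
apply: (Pr_none_open p01 (F := fun ij => detour u v ij.1 ij.2)).
- by move=> ij _; apply: detour_sub.
- by move=> ij _; apply: leq_trans (card_detour _ _ _ _) _; rewrite -[5%N]/(3 + 2)%N leq_add2r.
move=> [i j] [i' j']; rewrite !inE /= => /andP[iA jB] /andP[iA' jB'] neq.
have nAB k : k \in A -> k \in B -> False.
  by move=> kA; rewrite (disjointFr AB kA).
rewrite -setI_eq0; apply/eqP/setP => e; rewrite in_set0 in_setI.
apply/andP => -[e1 e2].
(* A common edge determines the set {i, j}; since [A] and [B] are disjoint, it determines the pair
   (i, j) as well. *)
have := detour_coord (negbT (disjointFr AD iA)) (negbT (disjointFr BD jB)) _ e1.
rewrite (detour_coord (negbT (disjointFr AD iA')) (negbT (disjointFr BD jB')) _ e2).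
- have ij : i != j by apply/eqP => ij; apply: (nAB i); rewrite // ij.
  move=> /(_ ij)/setP E; have := E i; have := E j; rewrite !inE !eqxx !orbT.
  move=> /orP[/eqP ji'|/eqP jj']; first by case: (nAB i'); rewrite // -ji'.
  move=> /orP[/eqP ii'|/eqP ij']; last by case: (nAB i); rewrite // ij'.
  by rewrite ii' jj' eqxx in neq.
- by apply/eqP => ij; apply: (nAB i'); rewrite // ij.
Qed.

Lemma Pr_far_isolated d n :
  Pr p (cube_edges d) (fun w => [exists x : cube d,
    [forall y in [set y | hamming x y == n], w :&: star y != set0]]) <=
  2 ^+ d * (1 - q ^+ d) ^+ 'C(d, n).
Proof.
apply: le_trans (_ : Pr p (cube_edges d) (fun w => [exists (x : cube d | true),
    [forall y in [set y | hamming x y == n], w :&: star y != set0]]) <= _).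
  exact: Pr_le.
apply: le_trans (Pr_exists_le p01 (b := (1 - q ^+ d) ^+ 'C(d, n)) _) _ => [x _|]; last first.
  apply: ler_wpM2r; first by rewrite exprn_ge0 // subr_ge0 exprn_ile1 // ltW.
  by rewrite -natrX -card_cube ler_nat max_card.
rewrite -(card_sphere x) -(Pr_none_closed p (E := cube_edges d) (F := @star d)) //.
- by move=> y _; apply: star_sub.
- by move=> y _; apply: card_star.
by move=> y z; rewrite !inE => /eqP hy /eqP hz; apply: (starsD (x := x)); rewrite hy hz.
Qed.

End Estimates.

(** * Structure of the fragment *)

Lemma eventually_and (P Q S : nat -> Prop) : (forall n, P n -> Q n -> S n) ->
  (\forall n \near \oo%classic, P n) -> (\forall n \near \oo%classic, Q n) ->
  \forall n \near \oo%classic, S n.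
Proof.
move=> PQS [a _ aP] [b _ bQ]; exists (maxn a b) => // n /=; rewrite geq_max.
by case/andP => /aP Pn /bQ Qn; apply: PQS.
Qed.

(** * Calculus of events of very high probability *)

Section VeryHighProbability.
Variables (R : realType) (p : R).
Hypothesis p01 : 0 <= p <= 1.
Implicit Types A B : forall d, pred {set {set cube d}}.

(** Half of the rate is given up to absorb [C], once exp(c d / 2) is at least [C]. *)
Lemma wvhp_Pr A (C c : R) : 0 < C -> 0 < c ->
  (\forall d \near \oo%classic,
     Pr p (cube_edges d) (predC (A d)) <= C * expR (- (c * d%:R))) ->
  wvhp p A.
Proof.
move=> C0 c0 H; exists (c / 2); first by rewrite divr_gt0.
move: H (nbhs_infty_ger (ln C / (c / 2))); apply: eventually_and => d HA; rewrite ler_pdivrMr ?divr_gt0 // => hd.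
rewrite prob_QpE PrC lerD2l lerN2; apply: le_trans HA _.
rewrite -{1}(@lnK R C) ?posrE // -expRD ler_expR.
by move: hd; lra.
Qed.

Lemma wvhp_and A B : wvhp p A -> wvhp p B ->
  wvhp p (fun d w => A d w && B d w).
Proof.
move=> [a a0 HA] [b b0 HB].
have m0 : 0 < Num.min a b by rewrite lt_min a0.
apply: (@wvhp_Pr _ 2 _ _ m0) => //; move: HA HB.
apply: eventually_and => d.
rewrite !prob_QpE !(PrC _ _ (_ d)) !lerD2l !lerN2 => HA HB.
apply: le_trans (_ : Pr p (cube_edges d) (predU (predC (A d)) (predC (B d))) <= _).
  by apply: Pr_le => // w _ /=; rewrite negb_and.
apply: le_trans (PrU p01 _ _ _) _; rewrite mulr_natl mulr2n.
by apply: lerD; [apply: le_trans HA _|apply: le_trans HB _];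
   rewrite ler_expR lerN2 ler_wpM2r // ge_min lexx ?orbT.
Qed.

Lemma wvhp_le A B :
  (\forall d \near \oo%classic, forall w : {set {set cube d}},
     w \subset cube_edges d -> A d w -> B d w) ->
  wvhp p A -> wvhp p B.
Proof.
move=> AB [a a0 HA]; exists a => //.
move: AB HA; apply: eventually_and => d AB HA.
apply: le_trans HA _; rewrite !prob_QpE; apply: Pr_le => // w.
by rewrite powersetE; apply: AB.
Qed.

End VeryHighProbability.

(** * Connectivity and sparsity with very high probability *)

Section Structure.
Import mathcomp.boot.fintype mathcomp.boot.finset.
Variables (R : realType) (p : R).
Hypothesis hp : 0 < p < 2^-1.

Let q : R := 1 - p.
Let p_gt0 : 0 < p. Proof. by case/andP: hp. Qed.
Let p_lt1 : p < 1. Proof. by case/andP: hp => _ ?; lra. Qed.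
Let p01 : 0 <= p <= 1. Proof. by rewrite !ltW. Qed.

Lemma wvhp_connected N : (0 < N)%N -> wvhp p (fun d w =>
  [forall u : cube d, forall v : cube d, [&& u \notin low N w, v \notin low N w
     & (hamming u v <= 3)%N] ==> connect (subgraph w) u v]).
Proof.
move=> N0; pose r : R := 1 - p ^+ 5.
have r0 : 0 < r by rewrite subr_gt0 exprn_ilt1 // ltW.
have r1 : ln r < 0 by rewrite ln_lt0 // r0 /= ltrBlDr ltrDl exprn_gt0.
(* With n = floor(d / (4N)), which is at least d / K for large d, the power r^(n^2) beats 16^d. The
   bound d >= 12 N gives n >= 3, hence 2n + 3 <= 4n. *)
pose K : R := 8 * N%:R.
have K0 : 0 < K by rewrite mulr_gt0 // ltr0n.
apply: (@wvhp_Pr _ _ _ 1 1) => //.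
have := nbhs_infty_ger ((ln 16 + 1) * K ^+ 2 / - ln r).
have := nbhs_infty_ge (12 * N)%N.
apply: eventually_and => d dN.
rewrite ler_pdivrMr ?oppr_gt0 // => hd.
pose n := (d %/ (4 * N))%N.
have N40 : (0 < 4 * N)%N by rewrite muln_gt0.
have n3 : (3 <= n)%N by rewrite leq_divRL // mulnA.
have nd : ((2 * n + 3) * N <= d)%N.
  apply: leq_trans (leq_divM d (4 * N)); rewrite -/n mulnA leq_mul2r.
  by rewrite (mulnC n) -[4%N]/(2 + 2)%N mulnDl leq_add2l; apply/orP; right; lia.
apply: le_trans (_ : 16 ^+ d * r ^+ (n * n) <= _).
  apply: le_trans (Pr_disconnected hp N0 nd); apply: Pr_le => // w _ /=.
  rewrite negb_forall => /existsP[u]; rewrite negb_forall => /existsP[v].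
  rewrite negb_imply => /andP[/and3P[uL vL uv] uvw].
  by apply/existsP; exists u; apply/existsP; exists v; rewrite uL vL uv.
have nK : d%:R / K <= n%:R :> R.
  rewrite ler_pdivrMr // mulrA -!natrM ler_nat.
  apply: ltnW; apply: leq_trans (ltn_ceil d N40) _; rewrite -/n mulnA -[8%N]/(2 * 4)%N.
  by rewrite !mulnA leq_mul2r leq_mul2r; apply/orP; right; apply/orP; right; lia.
rewrite mul1r -{1}(@lnK R 16) ?posrE // -{1}(@lnK R r) ?posrE //.
rewrite -!expRM_natr -expRD ler_expR natrM.
apply: le_trans (_ : ln 16 * d%:R + ln r * (d%:R / K * (d%:R / K)) <= _).
  rewrite lerD2l; apply: ler_wnM2l; first exact: ltW.
  by apply: ler_pM => //; rewrite divr_ge0 // ltW.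
have -> : ln r * (d%:R / K * (d%:R / K)) = - (- ln r * d%:R / K ^+ 2) * d%:R.
  by field; rewrite gt_eqF.
rewrite -mulrDl -[leRHS]mulNr; apply: ler_wpM2r => //.
rewrite lerBlDr -lerBlDl opprK ler_pdivlMr ?exprn_gt0 //.
by move: hd; lra.
Qed.

(** All the deterministic information about the fragment that the two halves of the result draw
    on. *)
Definition tame N M d (w : {set {set cube d}}) : bool :=
  [&& fragment (subgraph w) \subset low N w,
      [forall x : cube d, #|ball_Q (N%:R^-1 * d%:R : R) x :&: low N w| < M]%N
    & [forall u : cube d, (w :&: star u == set0) ==> (u \in fragment (subgraph w))]].

(** The hypothesis on [M] makes the union bound over centres and [M]-subsets decay: the factor 2 k
    is one k for the size of the balls and one for the rate of lowness. *)
Lemma tame_structure M (k : R) : 0 < k -> ln 2 + M%:R * (ln q + 2 * k) < 0 ->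
  exists2 N, (0 < N)%N &
    wvhp p (@tame N M) /\
    (forall g : R, g < - (ln q + k) -> wvhp p (fun d w =>
        #|low N w|%:R / #|cube d|%:R < expR (- (g * d%:R)))).
Proof.
move=> k0 hM; have [N N0 [ballN lowN]] := low_rate hp k0; exists N => //.
have few g : g < - (ln q + k) -> wvhp p (fun d w =>
        #|low N w|%:R / #|cube d|%:R < expR (- (g * d%:R))).
  move=> hg; have [C C0 HC] := lowN 1%N.
  have c0 : 0 < - (ln q + k) - g by rewrite subr_gt0.
  apply: (wvhp_Pr C0 c0); have := nbhs_infty_ge 1.
  apply: filterS => d d1.
  apply: le_trans (_ : (expR (- (g * d%:R)))^-1 * (C * expR ((ln q + k) * d%:R)) <= _).
    apply: le_trans (Pr_card_low hp (N := N) (expR_gt0 _) _).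
      by apply: Pr_le => // w _ /=; rewrite -leNgt.
    move=> u; have := HC d [set u] d1 (cards1 u); rewrite mul1r; exact.
  rewrite -expRN opprK mulrCA -expRD; apply: ler_wpM2l; rewrite ?(ltW C0) // ler_expR.
  by rewrite le_eqVlt; apply/orP; left; apply/eqP; ring.
split=> //; have [C C0 HC] := lowN M.
have c0 : 0 < - (ln 2 + M%:R * (ln q + 2 * k)) by rewrite oppr_gt0.
have sparse : wvhp p (fun d w =>
    [forall x : cube d, #|ball_Q (N%:R^-1 * d%:R : R) x :&: low N w| < M]%N).
  apply: (wvhp_Pr C0 c0); have := nbhs_infty_ge M.
  apply: filterS => d dM.
  apply: le_trans (_ : 2 ^+ d * (expR (k * d%:R) ^+ M *
      (C * expR (M%:R * (ln q + k) * d%:R))) <= _).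
    apply: le_trans (Pr_ball_low hp (r := N%:R^-1 * d%:R) (N := N) (M := M) _ _ _ _).
    - apply: Pr_le => // w _ /=; rewrite negb_forall => /existsP[x].
      by rewrite -leqNgt => ?; apply/existsP; exists x.
    - exact: expR_ge0.
    - by rewrite mulr_ge0 ?expR_ge0 ?ltW.
    - exact: ballN.
    - by move=> U; apply: HC.
  rewrite -{1}(@lnK R 2) ?posrE // -!expRM_natr [_ * (C * _)]mulrCA [_ * (C * _)]mulrCA.
  rewrite -!expRD; apply: ler_wpM2l; rewrite ?(ltW C0) // ler_expR.
  by rewrite le_eqVlt; apply/orP; left; apply/eqP; ring.
have M_gt0 : (0 < M)%N.
  rewrite lt0n; apply: contraTneq hM => ->; rewrite mul0r addr0 -leNgt.
  by rewrite ln_ge0 // ler1n.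
have lnqk : ln q + k < 0.
  have l2 : 0 <= ln 2 :> R by rewrite ln_ge0 // ler1n.
  have M0 : 0 < M%:R :> R by rewrite ltr0n.
  suff : ln q + 2 * k < 0 by move: k0; lra.
  by rewrite -(pmulr_rlt0 _ M0); move: hM l2; lra.
(* Any positive rate below -(ln q + k) would do here: it only has to make low vertices fewer than
   half of the cube. *)
pose g := - (ln q + k) / 2.
have g0 : 0 < g by rewrite divr_gt0 // oppr_gt0.
have := wvhp_and p01 (wvhp_and p01 (wvhp_connected N0) sparse) (few g _).
have /[swap]/[apply] : g < - (ln q + k) by rewrite /g; move: lnqk; lra.
apply: wvhp_le => //; have := nbhs_infty_ger (ln 2 / g).
have := nbhs_infty_ge (maxn N M); apply: eventually_and => d.
rewrite geq_max => /andP[dN dM]; rewrite ler_pdivrMr // => hd w wE.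
case/andP => /andP[/forallP conn /forallP sp] few_low.
have d_gt0 : (0 < d)%N by apply: leq_trans N0 dN.
have conn3 (u v : cube d) : u \notin low N w -> v \notin low N w ->
    (hamming u v <= 3)%N -> connect (subgraph w) u v.
  by move=> uL vL uv; have /forallP/(_ v)/implyP := conn u; apply; rewrite uL vL uv.
(* Otherwise the d >= M neighbours of u would all be low, and they lie in its ball of radius d/N,
   which is at least 1. *)
have dense (u : cube d) : exists2 v, v \notin low N w & (hamming u v <= 1)%N.
  case: (boolP [exists i, flip u i \notin low N w]) => [/existsP[i iL]|].
    by exists (flip u i); rewrite // /hamming diff_flip cards1.
  rewrite negb_exists => /forallP allL; have := sp u; rewrite ltnNge => /negP[].
  apply: leq_trans dM _; rewrite -[leqLHS]card_ord -(card_imset _ (@flip_inj d u)).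
  apply/subset_leq_card/subsetP => v /imsetP[i _ ->].
  have := allL i; rewrite negbK in_setI => ->; rewrite andbT inE gdist_hamming.
  by rewrite /hamming diff_flip cards1 ler_pdivlMl ?ltr0n // mulr1 ler_nat.
have half : (2 * #|low N w| < #|cube d|)%N.
  have cube0 : (0 < #|cube d|%:R :> R) by rewrite card_cube ltr0n expn_gt0.
  rewrite -(ltr_nat R) natrM mulrC -ltr_pdivlMr //.
  rewrite -(ltr_pM2r (x := #|cube d|%:R^-1)) ?invr_gt0 //.
  apply: lt_le_trans few_low _; rewrite [leRHS]mulrAC mulfV ?gt_eqF // mul1r.
  rewrite expRN lef_pV2 ?posrE ?expR_gt0 //.
  by rewrite -{1}(@lnK R 2) ?posrE // ler_expR mulrC.
apply/and3P; split.
- exact: fragment_low conn3 dense half.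
- exact/forallP.
by apply/forallP => u; apply/implyP; apply: isolated_fragment conn3 dense half _.
Qed.

End Structure.

(** * Entropy and binomial coefficients *)

Section Entropy.
Import numFieldNormedType.Exports.
Variable R : realType.
Implicit Types a b x : R.

(** Entropy in natural units, to match [expR] and [ln]. *)
Definition entropy_nat x : R := - x * ln x - (1 - x) * ln (1 - x).

Lemma entropyE x : entropy x = entropy_nat x / ln 2.
Proof. by rewrite /entropy /log2 /entropy_nat; ring. Qed.

Lemma ln2_gt0 : 0 < ln 2 :> R.
Proof. by rewrite ln_gt0 // ltr1n. Qed.

Lemma ln_sub_le a b : 0 < a -> 0 < b -> a * (ln b - ln a) <= b - a.
Proof.
move=> a0 b0; rewrite -ln_div ?posrE // mulrC -ler_pdivlMr //.
have /le_ln1Dx : -1 < b / a - 1 by rewrite ltrBrDl subrr divr_gt0.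
by rewrite subrKC mulrBl divff ?gt_eqF.
Qed.

(** Nonnegativity of relative entropy: add two instances of [ln_sub_le], whose right sides
    cancel. *)
Lemma gibbs a b : 0 < a < 1 -> 0 < b < 1 ->
  entropy_nat a <= - a * ln b - (1 - a) * ln (1 - b).
Proof.
move=> /andP[a0 a1] /andP[b0 b1].
have := ln_sub_le a0 b0.
have : (1 - a) * (ln (1 - b) - ln (1 - a)) <= (1 - b) - (1 - a).
  by apply: ln_sub_le; rewrite subr_gt0.
by rewrite /entropy_nat; lra.
Qed.

(** The cross-entropy bound of [gibbs] is affine in a with slope ln((1 - b) / b) > 0, and it equals
    the entropy at a = b. *)
Lemma entropy_nat_incr a b : 0 < a -> a < b -> b < 2^-1 ->
  entropy_nat a < entropy_nat b.
Proof.
move=> a0 ab b2; have b0 := lt_trans a0 ab.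
have b1 : b < 1 by lra.
apply: le_lt_trans (gibbs (a := a) (b := b) _ _) _.
- by rewrite a0 (lt_trans ab).
- by rewrite b0.
rewrite /entropy_nat -subr_gt0.
have : 0 < (b - a) * (ln (1 - b) - ln b).
  by rewrite mulr_gt0 ?subr_gt0 // ltr_ln ?posrE; lra.
by lra.
Qed.

Lemma entropy_nat_half : entropy_nat 2^-1 = ln 2.
Proof.
rewrite /entropy_nat [1 - 2^-1](_ : _ = 2^-1); last by field.
by rewrite lnV ?posrE //; field.
Qed.

Lemma continuous_entropy_nat x : 0 < x < 1 -> {for x, continuous entropy_nat}.
Proof.
move=> /andP[x0 x1]; apply: cvgB; apply: cvgM.
- by apply: cvgN; exact: cvg_id.
- exact: continuous_ln.
- by apply: cvgB; [exact: cvg_cst | exact: cvg_id].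
apply: (@continuous_comp _ _ _ (fun y : R => 1 - y) (@ln R)).
  by apply: cvgB; [exact: cvg_cst | exact: cvg_id].
by apply: continuous_ln; rewrite subr_gt0.
Qed.

(** Apply [gibbs] with b = c/2: as a tends to 0 the bound tends to -ln(1 - b), which is below -ln(1
    - c). This supplies a left endpoint away from 0 for the intermediate value theorem. *)
Lemma entropy_nat_small (c : R) : 0 < c < 1 ->
  exists2 a, 0 < a < 2^-1 & entropy_nat a < - ln (1 - c).
Proof.
move=> /andP[c0 c1]; pose b := c / 2.
have b0 : 0 < b by rewrite divr_gt0.
have b1 : b < 1 by rewrite /b; lra.
have L0 : 0 < - ln b by rewrite oppr_gt0 ln_lt0 ?b0.
have g0 : 0 < ln (1 - b) - ln (1 - c).
  by rewrite subr_gt0 ltr_ln ?posrE /b; lra.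
(* The second term makes a (-ln b) at most half of the gap; the first keeps a below 1/2. *)
pose a := Num.min 4^-1 ((ln (1 - b) - ln (1 - c)) / (2 * - ln b)).
have a0 : 0 < a by rewrite lt_min invr_gt0 ltr0n /= divr_gt0 ?mulr_gt0.
have a4 : a <= 4^-1 by rewrite ge_min lexx.
have aL : a * (2 * - ln b) <= ln (1 - b) - ln (1 - c).
  by rewrite -ler_pdivlMr ?mulr_gt0 // ge_min lexx orbT.
exists a; first by rewrite a0; lra.
apply: le_lt_trans (gibbs (b := b) _ _) _; first by rewrite a0; lra.
  by rewrite b0.
have : 0 <= a * - ln (1 - b).
  by rewrite mulr_ge0 ?ltW // oppr_gt0 ln_lt0 // subr_gt0 b1 /= ltrBlDr ltrDl.
by lra.
Qed.

Lemma entropy_nat_surj (c : R) : 0 < c < 2^-1 ->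
  exists2 x, 0 < x < 2^-1 & entropy_nat x = - ln (1 - c).
Proof.
move=> /andP[c0 c2]; have c01 : 0 < c < 1 by rewrite c0; lra.
have [a /andP[a0 a2] Ha] := entropy_nat_small c01.
have lnc : - ln (1 - c) < ln 2 :> R.
  have -> : ln 2 = - ln 2^-1 :> R by rewrite lnV ?posrE // opprK.
  by rewrite ltrN2 ltr_ln ?posrE; lra.
have [||x] := @IVT R entropy_nat a 2^-1 (- ln (1 - c)) (ltW a2).
- apply: continuous_in_subspaceT => x; rewrite inE /= in_itv /= => /andP[ax x2].
  by apply: continuous_entropy_nat; lra.
- by rewrite entropy_nat_half ge_min (ltW Ha) /= le_max (ltW lnc) orbT.
rewrite in_itv /= => /andP[ax x2] Hx; exists x => //.
rewrite (lt_le_trans a0 ax) lt_neqAle x2 andbT /=.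
by apply: contraTneq lnc => xh; rewrite -Hx xh entropy_nat_half ltxx.
Qed.

Lemma eta_starE (p : R) (x : R) : p < 1 ->
  entropy x = log2 (1 / (1 - p)) <-> entropy_nat x = - ln (1 - p).
Proof.
move=> p1; rewrite entropyE /log2 div1r lnV ?posrE ?subr_gt0 //.
have l2 : (ln 2 : R)^-1 != 0 by rewrite invr_neq0 // gt_eqF // ln2_gt0.
by split=> [/(mulIf l2)|->].
Qed.

Lemma eta_star_exists (p : R) : 0 < p < 2^-1 -> exists x, unique (is_eta_star p) x.
Proof.
move=> hp; have p1 : p < 1 by case/andP: hp => _; lra.
have [x x2 Hx] := entropy_nat_surj hp.
exists x; split=> [|y [y2 /eta_starE Hy]]; first by split=> //; apply/eta_starE.
have {}Hy := Hy p1.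
case/andP: x2 y2 => x0 x2 /andP[y0 y2].
have [xy|yx|//] := ltgtP x y.
  by have := entropy_nat_incr x0 xy y2; rewrite Hx Hy ltxx.
by have := entropy_nat_incr y0 yx x2; rewrite Hx Hy ltxx.
Qed.

(** The optimal Chernoff parameter t = ln((1 - x) / x), for which the bound of [card_ball] at radius
    x d has exponent exactly the entropy. *)
Lemma entropy_nat_tilt x : 0 < x < 2^-1 -> exists2 t, 0 < t &
  t * x + ln (1 + expR (- t)) = entropy_nat x.
Proof.
move=> /andP[x0 x2]; have x1 : 0 < 1 - x by lra.
exists (ln (1 - x) - ln x); first by rewrite subr_gt0 ltr_ln ?posrE; lra.
rewrite opprB expRB !lnK ?posrE //.
have -> : 1 + x / (1 - x) = (1 - x)^-1 by field; rewrite gt_eqF.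
by rewrite lnV ?posrE // /entropy_nat; ring.
Qed.

(** The terms l^i C(d, i), with l = x / (1 - x), are proportional to the binomial probabilities with
    parameter x. They peak at i = floor(x (d + 1)), so the sum of the d + 1 terms is at most d + 1
    times that term. *)
Lemma bin_mode d x : 0 < x < 1 ->
  (1 + x / (1 - x)) ^+ d <=
  d.+1%:R * ((x / (1 - x)) ^+ Num.truncn (x * d.+1%:R) *
             'C(d, Num.truncn (x * d.+1%:R))%:R).
Proof.
move=> /andP[x0 x1]; set l := x / (1 - x); set k := Num.truncn _.
have x1' : 0 < 1 - x by rewrite subr_gt0.
have l0 : 0 < l by rewrite divr_gt0.
have [kle klt] : k%:R <= x * d.+1%:R /\ x * d.+1%:R < k.+1%:R.
  by apply/andP; apply: truncn_itv; rewrite mulr_ge0 ?ltW.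
pose T i : R := l ^+ i * 'C(d, i)%:R.
have T0 i : 0 <= T i by rewrite mulr_ge0 ?exprn_ge0 // ltW.
have stepT i : (i <= d)%N -> i.+1%:R * T i.+1 = l * (d%:R - i%:R) * T i.
  move=> id; rewrite /T mulrCA -natrM mul_bin_left natrM natrB // exprS.
  by ring.
(* The terms grow from i to i + 1 as long as i + 1 is at most x (d + 1). *)
have lE i : l * (d%:R - i%:R) - i.+1%:R = (x * d.+1%:R - i.+1%:R) / (1 - x).
  by rewrite /l -!natr1; field; rewrite gt_eqF.
have kd : (k <= d)%N.
  rewrite -ltnS -(ltr_nat R); apply: le_lt_trans kle _.
  by rewrite gtr_pMl // ltr0n.
have up m : (m <= k)%N -> T (k - m)%N <= T k.
  elim: m => [|m IHm] mk; first by rewrite subn0.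
  apply: le_trans (IHm (ltnW mk)); set i := (k - m.+1)%N.
  have -> : (k - m)%N = i.+1 by rewrite /i subnSK.
  have ik : (i < k)%N by rewrite /i subnSK // leq_subr.
  rewrite -(ler_pM2l (x := i.+1%:R)) ?ltr0n // stepT ?(leq_trans (ltnW ik)) //.
  apply: ler_wpM2r => //; rewrite -subr_ge0 lE divr_ge0 ?(ltW x1') // subr_ge0.
  by apply: le_trans kle; rewrite ler_nat.
have down m : (k + m <= d)%N -> T (k + m)%N <= T k.
  elim: m => [|m IHm] mk; first by rewrite addn0.
  rewrite addnS in mk *; apply: le_trans (IHm (ltnW mk)); set i := (k + m)%N in mk *.
  rewrite -(ler_pM2l (x := i.+1%:R)) ?ltr0n // stepT; last by lia.
  apply: ler_wpM2r => //; rewrite -subr_le0 lE pmulr_lle0 ?invr_gt0 // subr_le0.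
  by apply: le_trans (ltW klt) _; rewrite ler_nat ltnS leq_addr.
have Tmax i : (i <= d)%N -> T i <= T k.
  move=> id; have [ik|ki] := leqP i k; first by have := up _ (leq_subr i k); rewrite subKn.
  by have := down (i - k)%N; rewrite subnKC ?(ltnW ki) // => /(_ id).
rewrite exprDn (eq_bigr (fun i : 'I_d.+1 => T i)) => [|i _]; last first.
  by rewrite expr1n mul1r -mulr_natr.
apply: le_trans (_ : \sum_(i < d.+1) T k <= _).
  by apply: ler_sum => i _; apply: Tmax; rewrite -ltnS.
by rewrite sumr_const card_ord mulr_natl.
Qed.

(** By [bin_mode], q^d C(d, k) is exp(a d) up to a factor linear in d; the cubic bound exp(y) >=
    (y/3)^3 beats that factor and 2 d together. *)
Lemma bin_entropy x q : 0 < x < 2^-1 -> 0 < q -> 0 < entropy_nat x + ln q ->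
  \forall d \near \oo%classic,
    2 * d%:R <= q ^+ d * 'C(d, Num.truncn (x * d.+1%:R))%:R.
Proof.
move=> /andP[x0 x2] q0; set a := entropy_nat x + ln q => a0.
have x1 : 0 < 1 - x by lra.
pose l := x / (1 - x).
have l0 : 0 < l by rewrite divr_gt0.
have ll0 : ln l < 0 by rewrite ln_lt0 // l0 ltr_pdivrMr // mul1r; lra.
have K0 : 0 < l * a ^+ 3 by rewrite mulr_gt0 // exprn_gt0.
(* 108 = 27 * 4: the 27 comes from (a d / 3)^3, the 4 from (d + 1) 2d <= 4 d^2. *)
move: (nbhs_infty_ger (108 / (l * a ^+ 3))) (nbhs_infty_ge 1).
apply: eventually_and => d hd d1.
set k := Num.truncn _.
have [kle klt] : k%:R <= x * d.+1%:R /\ x * d.+1%:R < k.+1%:R.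
  by apply/andP; apply: truncn_itv; rewrite mulr_ge0 ?ltW.
have D0 : 0 < d%:R :> R by rewrite ltr0n.
have big : l * expR (a * d%:R) <= d.+1%:R * (q ^+ d * 'C(d, k)%:R).
  (* Here 1 + l = 1 / (1 - x). Since l < 1 and k > x d - 1, the power l^k is at most the second
     exponential, which then cancels. *)
  have E : l * expR (a * d%:R) * expR (ln l * (x * d%:R - 1)) =
           q ^+ d * (1 + l) ^+ d.
    have -> : 1 + l = expR (- ln (1 - x)).
      by rewrite expRN lnK ?posrE // /l; field; rewrite gt_eqF.
    rewrite -{1}(@lnK R l) ?posrE // -[in q ^+ d](@lnK R q) ?posrE //.
    rewrite -!expRM_natr -!expRD; congr expR.
    by rewrite /a /entropy_nat /l ln_div ?posrE //; ring.
  have eq0 : 0 < expR (ln l * (x * d%:R - 1)) by exact: expR_gt0.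
  rewrite -(ler_pM2r eq0) E.
  apply: le_trans (_ : q ^+ d * (d.+1%:R * (l ^+ k * 'C(d, k)%:R)) <= _).
    apply: ler_wpM2l; first by rewrite exprn_ge0 // ltW.
    by apply: bin_mode; rewrite x0; lra.
  rewrite [leLHS](_ : _ = d.+1%:R * (q ^+ d * 'C(d, k)%:R) * l ^+ k); last by ring.
  apply: ler_wpM2l; first by rewrite !mulr_ge0 // exprn_ge0 // ltW.
  rewrite -[in leLHS](@lnK R l) ?posrE // -expRM_natr ler_expR.
  apply: ler_wnM2l; first exact: ltW.
  by move: klt; rewrite -!natr1; lra.
rewrite -(ler_pM2l (x := d.+1%:R)) ?ltr0n //; apply: le_trans big.
have e3 : (a * d%:R / 3) ^+ 3 <= expR (a * d%:R).
  rewrite [X in expR X](_ : _ = a * d%:R / 3 * 3%:R); last by field.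
  rewrite expRM_natr; apply: lerXn2r; rewrite ?nnegrE ?expR_ge0 //.
    by rewrite divr_ge0 // mulr_ge0 // ltW.
  by apply: le_trans (expR_ge1Dx _); rewrite lerDr.
apply: le_trans (_ : l * (a * d%:R / 3) ^+ 3 <= _); last by rewrite ler_wpM2l // ltW.
move: hd; rewrite ler_pdivrMr // => hd.
have -> : l * (a * d%:R / 3) ^+ 3 = d%:R * (l * a ^+ 3) * d%:R ^+ 2 / 27 by field.
rewrite ler_pdivlMr //; apply: le_trans (_ : 108 * d%:R ^+ 2 <= _); last first.
  by rewrite ler_wpM2r // exprn_ge0.
have : d.+1%:R <= 2 * d%:R :> R by rewrite -natrM ler_nat mul2n -addnn -add1n leq_add2r.
move: D0; move: (d.+1%:R : R) (d%:R : R) => y z z0 yz; nra.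
Qed.

End Entropy.

(** * Distances to the fragment *)

Section Fragment.
Import mathcomp.boot.fintype mathcomp.boot.finset.
Variables (R : realType) (p : R).
Hypothesis hp : 0 < p < 2^-1.

Let q : R := 1 - p.
Let p_gt0 : 0 < p. Proof. by case/andP: hp. Qed.
Let q_gt0 : 0 < q. Proof. by case/andP: hp => _ ?; rewrite /q; lra. Qed.
Let q_lt1 : q < 1. Proof. by rewrite /q ltrBlDr ltrDl. Qed.
Let p01 : 0 <= p <= 1. Proof. by rewrite (ltW p_gt0) -subr_ge0 (ltW q_gt0). Qed.
Let lnq_lt0 : ln q < 0. Proof. by rewrite ln_lt0 // q_gt0. Qed.

Lemma card_within d (S : {set cube d}) (r t : R) : 0 <= t ->
  #|[set u | within_Q r S u]|%:R <=
  #|S|%:R * (expR (t * r) * (1 + expR (- t)) ^+ d).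
Proof.
move=> t0; apply: le_trans (_ : \sum_(v in S) #|ball_Q r v|%:R <= _); last first.
  by rewrite mulr_natl -sumr_const; apply: ler_sum => v _; apply: card_ball.
rewrite -natr_sum ler_nat.
apply: leq_trans (_ : #|\bigcup_(v in S) ball_Q r v| <= _)%N.
  apply/subset_leq_card/subsetP => u; rewrite inE => /existsP[v /andP[vS uv]].
  by apply/bigcupP; exists v; rewrite // inE gdist_hamming hammingC -gdist_hamming.
elim/big_rec2: _ => [|v m B _ IH]; first by rewrite cards0.
by apply: leq_trans (leq_card_setU _ _) _; rewrite leq_add2l.
Qed.

(** The failure probability is at most 2^d exp(-q^d C(d, k)), and an exponent of 2 d already
    suffices. *)
Lemma wvhp_isolated (x : R) : 0 < x < 2^-1 -> 0 < entropy_nat x + ln q ->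
  wvhp p (fun d w => [forall u : cube d,
    [exists y in [set y | hamming u y == Num.truncn (x * d.+1%:R)],
      w :&: star y == set0]]).
Proof.
move=> x2 xq; apply: (@wvhp_Pr _ _ _ 1 1) => //.
move: (bin_entropy x2 q_gt0 xq) (nbhs_infty_ge 0); apply: eventually_and => d big _.
set k := Num.truncn _ in big *.
apply: le_trans (_ : 2 ^+ d * (1 - q ^+ d) ^+ 'C(d, k) <= _).
  apply: le_trans (Pr_far_isolated hp d k); apply: Pr_le => // w _ /=.
  rewrite negb_forall => /existsP[u]; rewrite negb_exists_in => far.
  by apply/existsP; exists u.
rewrite !mul1r; apply: le_trans (_ : expR d%:R * expR (- (2 * d%:R)) <= _); last first.
  by rewrite -expRD ler_expR; lra.
have qd1 : 0 <= 1 - q ^+ d by rewrite subr_ge0 exprn_ile1 // ltW.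
apply: ler_pM; rewrite ?exprn_ge0 //.
  rewrite -[X in expR X]mul1r expRM_natr; apply: lerXn2r; rewrite ?nnegrE ?expR_ge0 //.
  by apply: le_trans (expR_ge1Dx _).
apply: le_trans (_ : expR (- q ^+ d) ^+ 'C(d, k) <= _).
  by apply: lerXn2r; rewrite ?nnegrE ?expR_ge0 //; apply: expR_ge1Dx.
by rewrite -expRM_natr ler_expR mulNr lerN2.
Qed.

Lemma m_E : m_ p = Num.floor (ln 2 / - ln q).
Proof.
by rewrite /m_ /log2 -/q !div1r lnV ?posrE // invf_div.
Qed.

(** The integer M = m_p + 1 strictly exceeds ln 2 / (-ln q), so 2 q^M < 1 and a small k still
    fits. *)
Lemma m_gap : exists2 k : R, 0 < k &
  forall k', k' <= k -> ln 2 + (absz (m_ p)).+1%:R * (ln q + 2 * k') < 0.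
Proof.
set M := (absz (m_ p)).+1; have M0 : 0 < M%:R :> R by rewrite ltr0n.
have hM : ln 2 + M%:R * ln q < 0.
  have : ln 2 / - ln q < M%:R.
    apply: lt_le_trans (floorD1_gt _) _; rewrite -m_E /M -natr1 intrD lerD2r.
    by rewrite -[leRHS]/((absz (m_ p))%:~R) ler_int; case: (m_ p).
  by rewrite ltr_pdivrMr ?oppr_gt0 //; lra.
exists (- (ln 2 + M%:R * ln q) / (4 * M%:R)).
  by rewrite divr_gt0 ?oppr_gt0 // mulr_gt0.
move=> k'; rewrite ler_pdivlMr ?mulr_gt0 // => hk.
by rewrite mulrDr; lra.
Qed.

Lemma fragment_ball : exists delta : R, 0 < delta /\
  wvhp p (fun d w => [forall u : cube d,
    #|ball_Q (delta * d%:R) u :&: fragment (subgraph w)|%:Z <= m_ p]).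
Proof.
have [k k0 hk] := m_gap.
have [N N0 [tameN _]] := tame_structure hp k0 (hk k (lexx k)).
exists N%:R^-1; split; first by rewrite invr_gt0 ltr0n.
apply: wvhp_le tameN => //; apply: nearW => d w _ /and3P[frag /forallP sp _].
apply/forallP => u; set B := _ :&: _; have BM : (#|B| <= absz (m_ p))%N.
  rewrite -ltnS; apply: leq_ltn_trans (sp u).
  by apply/subset_leq_card; apply: setIS.
have m0 : 0 <= m_ p by rewrite m_E floor_ge0 divr_ge0 ?oppr_ge0 ?ltW // ln2_gt0.
by rewrite -(gez0_abs m0) lez_nat.
Qed.

(** Low vertices have density at most exp((ln q + 2k) d), and balls of radius (eta - eps) d have at
    most exp((-ln q - t eps) d) vertices. With k at most t eps / 4 the product is at most exp(-(t
    eps / 2) d). *)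
Lemma fragment_distance (eta eps : R) : 0 < eta < 2^-1 ->
  entropy_nat eta = - ln q -> 0 < eps ->
  exists gamma : R, 0 < gamma /\
    wvhp p (fun d w =>
      (#|[set u : cube d |
           within_Q ((eta - eps) * d%:R) (fragment (subgraph w)) u]|%:R
         / #|cube d|%:R <= expR (- (gamma * d%:R)))
      && [forall u : cube d,
           within_Q ((eta + eps) * d%:R) (fragment (subgraph w)) u]).
Proof.
move=> eta2 Heta eps0; have [t t0 Ht] := entropy_nat_tilt eta2.
have [k0 k0_gt0 hk0] := m_gap.
have te0 : 0 < t * eps by rewrite mulr_gt0.
pose k := Num.min k0 (t * eps / 4).
have k_gt0 : 0 < k by rewrite lt_min k0_gt0 divr_gt0.
have kk0 : k <= k0 by rewrite ge_min lexx.
have kte : k <= t * eps / 4 by rewrite ge_min lexx orbT.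
have [N N0 [tameN fewN]] := tame_structure hp k_gt0 (hk0 k kk0).
have {}fewN : wvhp p (fun d w =>
    #|low N w|%:R / #|cube d|%:R < expR (- ((- ln q - 2 * k) * d%:R))).
  by apply: fewN; rewrite -/q; lra.
(* A value strictly between eta and both eta + eps and 1/2; spheres of radius about x d then have
   exponentially more than q^(-d) vertices. *)
pose x := eta + Num.min eps (2^-1 - eta) / 2.
have [x_gt x_lt x2] : [/\ eta < x, x < eta + eps & x < 2^-1].
  have m0 : 0 < Num.min eps (2^-1 - eta) by rewrite lt_min eps0 subr_gt0; case/andP: eta2.
  have m1 : Num.min eps (2^-1 - eta) <= eps by rewrite ge_min lexx.
  have m2 : Num.min eps (2^-1 - eta) <= 2^-1 - eta by rewrite ge_min lexx orbT.
  by split; rewrite /x; lra.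
have eta0 : 0 < eta by case/andP: eta2.
have x0 : 0 < x by apply: lt_trans x_gt.
have isoN : wvhp p (fun d w => [forall u : cube d,
    [exists y in [set y | hamming u y == Num.truncn (x * d.+1%:R)],
      w :&: star y == set0]]).
  apply: wvhp_isolated; first by rewrite x0.
  by rewrite -[ln q]opprK -Heta subr_gt0; apply: entropy_nat_incr.
exists (t * eps / 2); split; first by rewrite divr_gt0.
apply: wvhp_le (wvhp_and p01 (wvhp_and p01 tameN fewN) isoN) => //.
(* From this dimension on, x (d + 1) is at most (eta + eps) d. *)
have := nbhs_infty_ger (x / (eta + eps - x)); apply: filterS => d hd w wE.
case/andP => /andP[/and3P[frag _ /forallP isol] few] /forallP iso.
have cube0 : (0 < #|cube d|%:R :> R) by rewrite card_cube ltr0n expn_gt0.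
apply/andP; split.
  apply: le_trans (_ : #|low N w|%:R / #|cube d|%:R *
     (expR (t * ((eta - eps) * d%:R)) * (1 + expR (- t)) ^+ d) <= _).
    rewrite mulrAC; apply: ler_wpM2r; first by rewrite invr_ge0 ltW.
    apply: le_trans (card_within _ _ (ltW t0)) _.
    apply: ler_wpM2r; first by rewrite mulr_ge0 ?expR_ge0 ?exprn_ge0 ?addr_ge0 ?expR_ge0.
    by rewrite ler_nat subset_leq_card.
  have e1 : 0 < 1 + expR (- t) by rewrite addr_gt0 ?expR_gt0.
  rewrite -(@lnK R (1 + _)) ?posrE // -expRM_natr -expRD.
  apply: le_trans (ler_wpM2r (expR_ge0 _) (ltW few)) _; rewrite -expRD ler_expR.
  have -> : ln (1 + expR (- t)) = - ln q - t * eta by rewrite -Heta -Ht; ring.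
  rewrite [leLHS](_ : _ = (2 * k - t * eps) * d%:R); last by ring.
  by rewrite -[leRHS]mulNr; apply: ler_wpM2r => //; lra.
apply/forallP => u; have /existsP[y] := iso u; rewrite inE => /andP[/eqP uy ystar].
apply/existsP; exists y; have /implyP/(_ ystar) -> := isol y; rewrite /= gdist_hamming uy.
have /andP[+ _] := truncn_itv (mulr_ge0 (ltW x0) (ler0n R d.+1)); move/le_trans; apply.
move: hd; rewrite ler_pdivrMr ?subr_gt0 // -natr1; lra.
Qed.

End Fragment.

Theorem theorem2 (R : realType) (p : R) (hp : 0 < p < 2^-1) :
  exists eta_star : R,
    unique (is_eta_star p) eta_star /\
    (exists delta : R, 0 < delta /\
       wvhp p (fun d w =>
         [forall u : cube d,
           #|ball_Q (delta * d%:R) u :&: fragment (subgraph w)|%:Z <= m_ p])) /\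
    (forall eps : R, 0 < eps ->
       exists gamma : R, 0 < gamma /\
       wvhp p (fun d w =>
         (#|[set u : cube d |
              within_Q ((eta_star - eps) * d%:R) (fragment (subgraph w)) u]|%:R
            / #|cube d|%:R <= expR (- (gamma * d%:R)))
         && [forall u : cube d,
              within_Q ((eta_star + eps) * d%:R) (fragment (subgraph w)) u])).
Proof.
have [eta [[eta2 etaE] eta_uniq]] := eta_star_exists hp.
have p1 : p < 1 by case/andP: hp => _; lra.
exists eta; split; first by split.
split; first exact: fragment_ball.
by move=> eps; apply: fragment_distance; rewrite //; apply/eta_starE.
Qed.
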